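(* Let $w=w_1w_2$ where $w_1,w_2\in F_d$ are non-trivial disjoint words. If $G=\mathrm{PSL}_2(q)$ where $q$ ranges over prime powers, then $$\lim_{q\to\infty}\Vert p_{w,G}-U_G\Vert_{L^2}=0.$$
   Context: $F_d$ is the free group on $x_1,\ldots,x_d$, whose elements are called words; two words are disjoint if they are words in disjoint sets of variables. A word $w\in F_d$ induces by substitution a word map $w\colon G^d\to G$. For a finite group $G$, $p_{w,G}(\{g\})=|w^{-1}(g)|/|G|^d$ and $U_G$ is the uniform distribution on $G$. For a real function $f$ on $G$, $\Vert f\Vert_{L^2}=\bigl(|G|\sum_{g\in G}|f(g)|^2\bigr)^{1/2}$ (distributions are identified with their point-mass functions). *)

(* Defs.v *)
From HB Require Import structures.
From mathcomp Require Import all_boot all_order all_algebra.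
From mathcomp Require Import all_fingroup all_solvable all_field.
From mathcomp Require Import all_classical all_reals all_analysis.
Set Implicit Arguments.
Unset Strict Implicit.
Unset Printing Implicit Defensive.

Import Order.TTheory GRing.Theory Num.Theory.
Import numFieldNormedType.Exports.

(* The free group F_d consists of the reduced sequences of letters, where the
   letter (i, false) is x_i and the letter (i, true) is x_i^-1; the product is
   the reduction of the concatenation. *)
Notation letter d := ('I_d * bool)%type.

Definition linv d (a : letter d) : letter d := (a.1, ~~ a.2).

Definition reduced d (s : seq (letter d)) : bool :=
  sorted (fun a b => b != linv a) s.

Record free_group (d : nat) : Type :=
  FreeWord { letters :> seq (letter d); letters_reduced : reduced letters }.

HB.instance Definition _ d := [isSub for @letters d].
HB.instance Definition _ d := [Choice of free_group d by <:].

Definition lcons d (a : letter d) (s : seq (letter d)) : seq (letter d) :=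
  if s is b :: s' then if b == linv a then s' else a :: s else [:: a].

Section FreeGroupTheory.
Variable d : nat.
Implicit Types (a b : letter d) (s t u : seq (letter d)).

Lemma linvK : involutive (@linv d).
Proof. by case=> i e; rewrite /linv /= negbK. Qed.

Lemma reduced_behead a s : reduced (a :: s) -> reduced s.
Proof. exact: path_sorted. Qed.

Lemma lcons_reduced a s : reduced s -> reduced (lcons a s).
Proof.
case: s => [|b s] //= rs; case: eqP => [_|/eqP nba]; first exact: path_sorted rs.
by rewrite /= nba.
Qed.

Lemma lcons_id a s : reduced (a :: s) -> lcons a s = a :: s.
Proof. by case: s => [|b s] //= /andP[/negPf->]. Qed.

Lemma lconsK a s : reduced s -> lcons (linv a) (lcons a s) = s.
Proof.
case: s => [|b s] /=; first by rewrite linvK eqxx.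
case: (b =P linv a) => [-> rs|_ _]; first exact: lcons_id.
by rewrite /= linvK eqxx.
Qed.

Lemma lconsKV a s : reduced s -> lcons a (lcons (linv a) s) = s.
Proof. by move=> rs; rewrite -{1}[a]linvK lconsK. Qed.

Definition lmul s t : seq (letter d) := foldr (@lcons d) t s.

Lemma lmul_reduced s t : reduced t -> reduced (lmul s t).
Proof. by move=> rt; elim: s => //= a s; apply: lcons_reduced. Qed.

Lemma lmul_lcons a s t : reduced t -> reduced s ->
  lmul (lcons a s) t = lcons a (lmul s t).
Proof.
move=> rt; case: s => [|b s] //= rs.
by case: (b =P linv a) => [->|//]; rewrite lconsKV // lmul_reduced.
Qed.

Lemma lmulA s t u : reduced t -> reduced u ->
  lmul s (lmul t u) = lmul (lmul s t) u.
Proof.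
by move=> rt ru; elim: s => //= a s ->; rewrite lmul_lcons // lmul_reduced.
Qed.

Lemma lmuls0 s : reduced s -> lmul s [::] = s.
Proof.
elim: s => //= a s IHs rs.
by rewrite IHs ?lcons_id //; apply: reduced_behead rs.
Qed.

Definition linvs s : seq (letter d) := rev (map (@linv d) s).

Lemma linvs_reduced s : reduced s -> reduced (linvs s).
Proof.
rewrite /reduced /linvs rev_sorted sorted_map; apply: sub_sorted => a b /=.
by apply: contraNN => /eqP ->; rewrite linvK.
Qed.

Lemma linvsK s : linvs (linvs s) = s.
Proof. by rewrite /linvs map_rev revK mapK //; apply: linvK. Qed.

Lemma lmulV s : reduced s -> lmul (linvs s) s = [::].
Proof.
move=> rs; rewrite -{2}(lmuls0 rs).
have: reduced ([::] : seq (letter d)) by [].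
elim: s {rs} [::] => // a s IHs t rt.
rewrite /linvs /= rev_cons /lmul foldr_rcons -/(lmul s t) lconsK ?lmul_reduced //.
exact: IHs.
Qed.

Definition fmul (v w : free_group d) : free_group d :=
  FreeWord (lmul_reduced (letters v) (letters_reduced w)).
Definition fone : free_group d := @FreeWord d [::] isT.
Definition finv (w : free_group d) : free_group d :=
  FreeWord (linvs_reduced (letters_reduced w)).

Lemma fmulA : associative fmul.
Proof. by move=> u v w; apply: val_inj; rewrite /= lmulA // letters_reduced. Qed.
Lemma fmul1 : left_id fone fmul.
Proof. by move=> w; apply: val_inj. Qed.
Lemma fmulg1 : right_id fone fmul.
Proof. by move=> w; apply: val_inj; rewrite /= lmuls0 // letters_reduced. Qed.
Lemma fmulV : left_inverse fone finv fmul.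
Proof. by move=> w; apply: val_inj; rewrite /= lmulV // letters_reduced. Qed.
Lemma fmulgV : right_inverse fone finv fmul.
Proof.
move=> w; apply: val_inj; rewrite /= -[X in lmul X]linvsK lmulV //.
by rewrite linvs_reduced // letters_reduced.
Qed.

HB.instance Definition _ := isGroup.Build (free_group d)
  fmulA fmul1 fmulg1 fmulV fmulgV.

End FreeGroupTheory.

Definition fgen d (i : 'I_d) : free_group d := @FreeWord d [:: (i, false)] isT.

Section WordMap.
Local Open Scope group_scope.

Definition letter_map d (G : groupType) (x : 'I_d -> G) (a : letter d) : G :=
  if a.2 then (x a.1)^-1 else x a.1.

Definition word_map d (G : groupType) (w : free_group d) (x : 'I_d -> G) : G :=
  \prod_(a <- letters w) letter_map x a.

(* The next three lemmas give the universal property of F_d. *)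

Lemma word_map_gen d (G : groupType) (x : 'I_d -> G) i :
  word_map (fgen i) x = x i.
Proof. by rewrite /word_map big_seq1. Qed.

Lemma word_mapM d (G : groupType) (x : 'I_d -> G) (v w : free_group d) :
  word_map (v * w) x = word_map v x * word_map w x.
Proof.
rewrite /word_map /=; case: v w => s rs [t rt] /=.
elim: s {rs} => [|a s IHs] /=; first by rewrite big_nil mul1g.
rewrite big_cons -mulgA -{}IHs; case: (lmul s t) => [|b u] /=.
  by rewrite big_seq1 big_nil mulg1.
case: eqP => [->|_]; last by rewrite big_cons.
rewrite big_cons /letter_map /=.
by case: a.2; rewrite /= ?mulKg ?mulKVg.
Qed.

Lemma word_map_id d (w : free_group d) : word_map w (@fgen d) = w.
Proof.
case: w => s rs; apply: val_inj; rewrite /word_map /=.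
elim: s rs => [|a s IHs] rs; first by rewrite big_nil.
rewrite big_cons /= -[RHS](lcons_id rs) -[in RHS]IHs ?(reduced_behead rs) //.
by case: a {rs} => i [].
Qed.

Definition word_in d (A : {set 'I_d}) (w : free_group d) : bool :=
  all (fun a : letter d => a.1 \in A) (letters w).

Definition disjoint_words d (v w : free_group d) : Prop :=
  exists A B : {set 'I_d}, [/\ [disjoint A & B], word_in A v & word_in B w].

End WordMap.

Section Distributions.
Local Open Scope ring_scope.

Definition word_distr (R : realType) d (w : free_group d)
    (gT : finGroupType) (G : {group gT}) (g : gT) : R :=
  #|[set x : {ffun 'I_d -> gT} | (x \in ffun_on (mem G)) &&
                                 (word_map w x == g)]|%:R / #|G|%:R ^+ d.

Definition unif_distr (R : realType) (gT : finGroupType) (G : {group gT})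
    (g : gT) : R := if g \in G then #|G|%:R^-1 else 0.

Definition L2norm (R : realType) (gT : finGroupType) (G : {group gT})
    (f : gT -> R) : R := Num.sqrt (#|G|%:R * \sum_(g in G) `|f g| ^+ 2).

End Distributions.

Definition prime_power (q : nat) : Prop :=
  exists p k : nat, [/\ prime p, (0 < k)%N & q = (p ^ k)%N].

Lemma logn_pdiv_gt0 q : (1 < q)%N -> (0 < logn (pdiv q) q)%N.
Proof.
by move=> q1; rewrite logn_gt0 mem_primes pdiv_prime // pdiv_dvd (ltnW q1).
Qed.

(* The field with q elements, for q a prime power (see card_GF); for the other
   values of q this is an irrelevant finite field. *)
Definition GF (q : nat) : finFieldType :=
  match boolP (1 < q)%N with
  | AltTrue q1 => s2val (pPrimePowerField (pdiv_prime q1) (logn_pdiv_gt0 q1))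
  | AltFalse _ => 'F_2
  end.

Lemma card_GF q : prime_power q -> #|GF q| = q.
Proof.
case=> p [[|k] [pr_p // _ ->]]; rewrite /GF; case: {-}_ / boolP => [q1|].
  by rewrite (s2valP' (pPrimePowerField _ _)) pdiv_pfactor // pfactorK.
by rewrite -(expn0 p) ltn_exp2l ?prime_gt1.
Qed.

Section PSL2.
Local Open Scope group_scope.
Variable F : finFieldType.

Definition SL2_set : {set {'GL_2[F]}} := [set u | (\det (GLval u) == 1)%R].

Lemma SL2_group_set : group_set SL2_set.
Proof.
apply/group_setP; split=> [|u v]; first by rewrite inE GL_1E det1.
by rewrite !inE GL_ME det_mulmx => /eqP -> /eqP ->; rewrite mulr1.
Qed.

Canonical SL2 : {group {'GL_2[F]}} := Group SL2_group_set.

Definition PSL2 : {group coset_of 'Z(SL2)} := (SL2 / 'Z(SL2))%G.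

End PSL2.

(* Main.v *)
(* Characters are avoided: everything is read off from traces in G = SL_2(q).
   First, tr w takes every value with probability O(1/q) for a non-trivial w:
   one may take w cyclically reduced, and when x_i = A_i U(t) B_i^-1 with
   U(t) = [1, t; 0, 1] and uniform A_i, B_i, t, the leading coefficient of tr w
   in t is, up to sign, a product of lower-left entries of uniform elements of G,
   so it rarely vanishes.
   Second, elements of G that are not scalar are conjugate in GL_2(q) as soon as
   they have the same trace, so p_w is a function of the trace outside the centre,
   and has values O(q^-3) there.
   Finally, for disjoint words p_{w1 w2} is the convolution of p_w1 and p_w2.
   For a fixed non-scalar g, the pair (tr a, tr ag) is almost equidistributed in
   F_q^2 when a runs over G (by a second moment computation), whence
   p_{w1 w2}(g) <= (1 + O(q^-1/2)) / |G|.  This makes the collision probability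
   sum_g p(g)^2 at most (1 + O(q^-1/2)) / |G|, i.e. the L^2 distance to the uniform
   distribution is O(q^-1/4), and passing to PSL_2(q) can only decrease it. *)

Require Import Defs.
From mathcomp Require Import all_boot all_order all_algebra.
From mathcomp Require Import all_fingroup all_solvable all_field.
From mathcomp Require Import all_classical all_reals all_analysis.
From mathcomp Require Import ring lra zify.
Set Implicit Arguments.
Unset Strict Implicit.
Unset Printing Implicit Defensive.
Import Order.TTheory GRing.Theory Num.Theory.
Import numFieldNormedType.Exports.

(** * Word maps and convolution *)

Section WordMaps.
Local Open Scope group_scope.

Lemma word_map_eq_in d (G : groupType) (A : {set 'I_d}) (w : free_group d)
    (x y : 'I_d -> G) :
  word_in A w -> {in A, x =1 y} -> word_map w x = word_map w y.
Proof.
move=> /allP wA xy; apply: eq_big_seq => a /wA aA.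
by rewrite /letter_map xy.
Qed.

Lemma word_map_morph d (G H : groupType) (f : G -> H) (w : free_group d)
    (x : 'I_d -> G) :
  {morph f : u v / u * v} -> f (word_map w x) = word_map w (f \o x).
Proof.
move=> fM; have f1 : f 1 = 1 by apply: (mulgI (f 1)); rewrite -fM !mulg1.
have fV u : f u^-1 = (f u)^-1.
  by apply: (mulgI (f u)); rewrite -fM !mulgV.
rewrite /word_map (big_morph f fM f1); apply: eq_bigr => a _.
by rewrite /letter_map; case: a.2 => //=; rewrite fV.
Qed.

Definition nb_sol (T : finGroupType) d (w : free_group d) (g : T) : nat :=
  #|[set x : {ffun 'I_d -> T} | word_map w x == g]|.

Lemma nb_solE (T : finGroupType) d (w : free_group d) (g : T) :
  nb_sol w g = \sum_(x : {ffun 'I_d -> T}) (word_map w x == g).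
Proof. by rewrite /nb_sol cardsE -sum1_card big_mkcond. Qed.

Lemma sum_nb_sol (T : finGroupType) d (w : free_group d) (P : pred T) :
  \sum_(g | P g) nb_sol w g = #|[set x : {ffun 'I_d -> T} | P (word_map w x)]|.
Proof.
rewrite cardsE -sum1_card [RHS]big_mkcond /=.
under eq_bigr do rewrite nb_solE.
rewrite exchange_big; apply: eq_bigr => x _ /=.
rewrite big_mkcond (bigD1 (word_map w x)) //= eqxx big1 ?addn0; last first.
  by move=> g /negPf; rewrite eq_sym => ->; case: ifP.
by case: ifP.
Qed.

(* Exchanging the coordinates outside A between two tuples x, y turns the pair of
   values (w1(x), w2(y)) into the values of w1 and w2 at one and the same tuple. *)
Lemma nb_solM (T : finGroupType) d (w1 w2 : free_group d) (g : T) :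
  disjoint_words w1 w2 ->
  (#|T| ^ d * nb_sol (w1 * w2)%g g =
   \sum_(a : T) nb_sol w1 a^-1%g * nb_sol w2 (a * g)%g)%N.
Proof.
case=> A [B [disAB wA wB]].
pose mix (x y : {ffun 'I_d -> T}) := [ffun i => if i \in A then x i else y i].
pose sw (u : {ffun 'I_d -> T} * {ffun 'I_d -> T}) := (mix u.1 u.2, mix u.2 u.1).
have swK : involutive sw.
  move=> [x y]; rewrite /sw /=; congr pair; apply/ffunP => i; rewrite !ffunE;
  by case: (i \in A).
transitivity (\sum_(u : {ffun 'I_d -> T} * {ffun 'I_d -> T})
    (word_map w1 u.1 * word_map w2 u.2 == g)%g)%N.
  rewrite (reindex_inj (inv_inj swK)) /=.
  transitivity (\sum_(u : {ffun 'I_d -> T} * {ffun 'I_d -> T})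
      (word_map (w1 * w2)%g u.1 == g))%N.
    rewrite -(pair_bigA _ (fun (x _ : {ffun 'I_d -> T}) =>
        (word_map (w1 * w2) x == g : nat))) /= exchange_big /=.
    by rewrite sum_nat_const card_ffun card_ord -nb_solE.
  apply: eq_bigr => -[x y] _ /=; rewrite word_mapM.
  congr (nat_of_bool (_ * _ == g)).
    by apply: word_map_eq_in wA _ => i iA; rewrite ffunE iA.
  apply: word_map_eq_in wB _ => i iB; rewrite ffunE.
  by rewrite (disjointFl disAB iB).
rewrite -(pair_bigA _ (fun x y : {ffun 'I_d -> T} =>
    (word_map w1 x * word_map w2 y == g : nat))) /=.
under [RHS]eq_bigr => a _ do rewrite !nb_solE big_distrl /=.
rewrite [RHS]exchange_big; apply: eq_bigr => x _ /=.
rewrite (bigD1 (word_map w1 x)^-1) //= invgK eqxx mul1n.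
rewrite [X in (_ + X)%N]big1 ?addn0.
  apply: eq_bigr => y _; congr nat_of_bool.
  by rewrite -[RHS](inj_eq (mulgI (word_map w1 x))) mulKVg.
move=> a; rewrite -(inj_eq invg_inj) invgK => /negPf.
by rewrite eq_sym => ->.
Qed.

End WordMaps.

(** * Passing to a quotient *)

Section Pushforward.
Local Open Scope ring_scope.

(** Cauchy-Schwarz against a constant: if s is the sum, k the number of indices and t the sum of
    squares, then the sum of (k a_i - s)^2 equals k (k t - s^2). *)
Lemma sum_sqr_le (R : realFieldType) (I : finType) (P : pred I) (a : I -> R) :
  (\sum_(i | P i) a i) ^+ 2 <= #|P|%:R * \sum_(i | P i) a i ^+ 2.
Proof.
set s := \sum_(i | P i) a i; have [P0|P_gt0] := posnP #|P|.
  rewrite P0 mul0r /s big_pred0 ?expr0n // => i.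
  exact: (card0_eq P0 i).
have k0 : 0 < #|P|%:R :> R by rewrite ltr0n.
have : 0 <= \sum_(i | P i) (a i * #|P|%:R - s) ^+ 2.
  by apply: sumr_ge0 => i _; apply: sqr_ge0.
rewrite (eq_bigr (fun i => a i ^+ 2 * #|P|%:R ^+ 2 - a i * (#|P|%:R * s * 2)
  + s ^+ 2)) => [|i _]; last by ring.
rewrite big_split sumrB /= -!mulr_suml -/s sumr_const -mulr_natr.
by set t := \sum_(i | P i) _ => h; rewrite -(ler_pM2r k0); nra.
Qed.

(** Right translation by a preimage of [h] carries the kernel onto the fibre over [h]. *)
Lemma card_fiber (T hT : finGroupType) (H : {group hT}) (f : T -> hT) :
  {morph f : u v / (u * v)%g} -> f @: [set: T]%SET = H -> forall h, h \in H ->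
  #|[pred g | f g == h]| = #|[pred g | f g == 1%g]|.
Proof.
move=> fM fT h; rewrite -fT => /imsetP[g0 _ ->].
rewrite -[RHS](fintype.card_image (mulIg g0)); apply: eq_card => g; rewrite inE.
apply/eqP/fintype.imageP => [fg|[u /eqP fu ->]].
  exists (g * g0^-1)%g; rewrite ?mulgKV // inE.
  by apply/eqP; apply: (mulIg (f g0)); rewrite -fM mulgKV mul1g.
by rewrite fM fu mul1g.
Qed.

(** The mass at [h] is the sum of the masses of the [k] points in the fibre over [h]. Cauchy-Schwarz
    on each fibre costs a factor k, and |T| = |H| k absorbs it. *)
Lemma collision_le (R : realType) (T hT : finGroupType) (H : {group hT})
    (f : T -> hT) d (w : free_group d) :
  {morph f : u v / (u * v)%g} -> f @: [set: T]%SET = H ->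
  #|H|%:R * \sum_(h in H) word_distr R w H h ^+ 2 <=
  #|T|%:R * \sum_(g : T) ((nb_sol w g)%:R / #|T|%:R ^+ d) ^+ 2.
Proof.
move=> fM fT; set k := #|[pred g | f g == 1%g]|.
have fH g : f g \in H by rewrite -fT imset_f.
have fib := card_fiber fM fT; rewrite -/k in fib.
have cT : #|T| = (#|H| * k)%N.
  rewrite -[LHS]sum1_card (partition_big f [in H]) //=.
  by rewrite (eq_bigr (fun=> k)) ?sum_nat_const // => h hH; rewrite sum1_card fib.
have k0 : (k%:R : R) != 0.
  by rewrite pnatr_eq0; apply: contraTneq (cardG_gt0 [group of [set: T]]) => k0;
     rewrite cardsT cT k0 muln0.
(* Each tuple over H with value [h] lifts to exactly k^d tuples over T: one free choice in a fibre
   for each coordinate. *)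
have nb h : h \in H -> (\sum_(g | f g == h) nb_sol w g =
    k ^ d * #|[set x : {ffun 'I_d -> hT} | (x \in ffun_on (mem H)) &&
                                 (word_map w x == h)]|)%N.
  move=> hH; rewrite sum_nb_sol cardsE -sum1_card.
  pose F (x : {ffun 'I_d -> T}) := [ffun i => f (x i)].
  rewrite (partition_big F [in [set x : {ffun 'I_d -> hT} |
      (x \in ffun_on (mem H)) && (word_map w x == h)]]) /=; last first.
    move=> x; rewrite unfold_in (word_map_morph _ _ fM) => /eqP wx.
    rewrite inE.
    apply/andP; split; first by apply/ffun_onP => i; rewrite ffunE.
    apply/eqP; rewrite -wx; apply: eq_bigr => a _.
    by rewrite /letter_map !ffunE.
  rewrite (eq_bigr (fun=> k ^ d)%N) ?sum_nat_const 1?mulnC // => y.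
  rewrite inE => /andP[/ffun_onP yH /eqP wy].
  rewrite sum1_card -[RHS](_ : #|family (fun i => [pred g | f g == y i])| = _).
    apply: eq_card => x; rewrite !inE; apply/andP/familyP => [[_ /eqP <-] i|xy].
      by rewrite inE ffunE.
    have Fxy : F x = y by apply/ffunP => i; rewrite ffunE; apply/eqP; apply: xy.
    split; last exact/eqP.
    rewrite unfold_in (word_map_morph _ _ fM) -wy -Fxy; apply/eqP.
    by apply: eq_bigr => a _; rewrite /letter_map !ffunE.
  rewrite card_family -[d in RHS]card_ord cardT /image_mem.
  by elim: (enum _) => //= i s ->; rewrite fib ?expnS // ; apply: yH.
have wd h : h \in H -> word_distr R w H h =
    \sum_(g | f g == h) ((nb_sol w g)%:R / #|T|%:R ^+ d).
  move=> hH; rewrite -mulr_suml -natr_sum nb // natrM natrX cT natrM exprMn.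
  by rewrite invfM [_ ^+ d * _]mulrC mulrACA divff ?mulr1 // expf_neq0.
rewrite [X in _ <= X%:R * _]cT (partition_big f [in H]) //= natrM -mulrA.
rewrite ler_wpM2l // mulr_sumr.
apply: ler_sum => h hH; rewrite wd // -(fib h hH); exact: sum_sqr_le.
Qed.

End Pushforward.

(** * Counting in SL_2 *)

Section SL2Matrices.
Variable F : finFieldType.
Local Open Scope ring_scope.

Notation SLt := (subg_of (SL2 F)).
Implicit Types (u v : SLt) (A B : 'M[F]_2).

Definition smx u : 'M[F]_2 := GLval (sgval u).

Lemma smxM u v : smx (u * v)%g = smx u *m smx v.
Proof. by []. Qed.

Lemma smx1 : smx 1%g = 1%:M.
Proof. by []. Qed.

Lemma smx_inj : injective smx.
Proof. by move=> u v uv; apply: val_inj; apply: val_inj. Qed.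

Lemma det_smx u : \det (smx u) = 1.
Proof. by have := subgP u; rewrite inE => /eqP. Qed.

Lemma smx_surj A : \det A = 1 -> exists u, smx u = A.
Proof.
move=> A1; have uA : A \in unitmx by rewrite unitmxE A1 unitr1.
pose a : {'GL_2[F]} := FinRing.unit _ uA.
have sA : a \in SL2 F by rewrite inE; apply/eqP.
by exists (subg (SL2 F) (FinRing.unit _ uA)); rewrite /smx subgK.
Qed.

Lemma sum2 (V : nmodType) (f : 'I_2 -> V) : \sum_i f i = f 0 + f 1.
Proof.
by rewrite !big_ord_recl big_ord0 addr0; congr (_ + f _); apply: val_inj.
Qed.

Lemma det22 A : \det A = A 0 0 * A 1 1 - A 0 1 * A 1 0.
Proof.
rewrite (expand_det_row _ 0) sum2 /cofactor !det_mx11 !mxE /= !expr1 expr0.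
rewrite mul1r mulN1r mulrN.
by congr (_ * A _ _ - _ * A _ _); apply: val_inj.
Qed.

Lemma tr22 A : \tr A = A 0 0 + A 1 1.
Proof. exact: sum2. Qed.

Lemma matrix22P A B : A 0 0 = B 0 0 -> A 0 1 = B 0 1 -> A 1 0 = B 1 0 ->
  A 1 1 = B 1 1 -> A = B.
Proof.
move=> e00 e01 e10 e11; apply/matrixP => i j.
have l1 : lift 0 0 = 1 :> 'I_2 by apply: val_inj.
by case: (fintype.unliftP 0 i) => [i' ->|->]; rewrite ?ord1 ?l1;
  case: (fintype.unliftP 0 j) => [j' ->|->]; rewrite ?ord1 ?l1.
Qed.

(** Cayley-Hamilton in determinant 1. *)
Lemma smxV u : smx u^-1%g = (\tr (smx u))%:M - smx u.
Proof.
have uV : smx u *m ((\tr (smx u))%:M - smx u) = 1%:M.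
  have := det_smx u; rewrite det22; move: (smx u) => A d1.
  by apply: matrix22P; rewrite !mxE !sum2 !mxE tr22 /= ?mulr1n ?mulr0n -?d1; ring.
by rewrite -[RHS]mul1mx -[1%:M]smx1 -(mulVg u) smxM -mulmxA uV mulmx1.
Qed.

Lemma tr_smxV u : \tr (smx u^-1%g) = \tr (smx u).
Proof. by rewrite smxV raddfB /= mxtrace_scalar mulr2n addrK. Qed.

End SL2Matrices.

Section Counting.
Variable F : finFieldType.
Local Open Scope ring_scope.

Notation SLt := (subg_of (SL2 F)).
Notation q := #|F|.
Implicit Types (A B V : 'M[F]_2) (x y z t e delta : F).

Definition mx4 x y z t : 'M[F]_2 :=
  \matrix_(i, j) if i == 0 then (if j == 0 then x else y)
                 else (if j == 0 then z else t).

Lemma card_mx4 (P : pred 'M[F]_2) :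
  #|P| = (\sum_x \sum_y \sum_z \sum_t P (mx4 x y z t))%N.
Proof.
rewrite -sum1_card big_mkcond /=.
pose f (u : F * (F * (F * F))) := mx4 u.1 u.2.1 u.2.2.1 u.2.2.2.
pose g A := (A 0 0, (A 0 1, (A 1 0, A 1 1))).
have fK : cancel f g by move=> [x [y [z t]]]; rewrite /f /g !mxE.
have gK : cancel g f by move=> A; apply: matrix22P; rewrite !mxE.
rewrite (reindex f) /=; last by exists g => u _; [apply: fK | apply: gK].
have fin (I : finType) (h : F -> I -> nat) :
  (\sum_x \sum_i h x i = \sum_u h u.1 u.2)%N by rewrite pair_bigA.
under [RHS]eq_bigr => x _.
  under eq_bigr => y _ do rewrite fin.
  rewrite fin; over.
by rewrite fin.
Qed.

(** Each y != 0 determines z; y = 0 contributes q pairs exactly when c = 0. *)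
Lemma card_mul_eq (c : F) : (\sum_y \sum_z ((y * z)%R == c) = q.-1 + q * (c == 0%R))%N.
Proof.
rewrite (bigD1 0) //= addnC; congr (_ + _)%N.
  rewrite (eq_bigr (fun=> 1%N)) => [|y y0]; first by rewrite sum1_card cardC1.
  rewrite (bigD1 (c / y)) //= mulrC divfK // eqxx big1 // => z zc.
  by case: eqP => // h; rewrite -h mulrC mulKf // eqxx in zc.
rewrite (eq_bigr (fun=> (c == 0%R) : nat)) => [|z _]; first by rewrite sum_nat_const.
by rewrite mul0r eq_sym.
Qed.

Lemma card_quadratic delta e : (\sum_x ((x * (e - x))%R == delta) <= 2)%N.
Proof.
have -> : (\sum_x ((x * (e - x))%R == delta) = #|[pred x : F | (x * (e - x))%R == delta]|)%N.
  by rewrite -sum1_card [RHS]big_mkcond.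
have [x0 /= /eqP hx0|no] := pickP [pred x : F | (x * (e - x))%R == delta]; last first.
  by rewrite eq_card0.
(* The substitution x -> e - x preserves x (e - x), so a root [x0] brings the root e - x0, and the
   difference of the values at x and x0 is -(x - x0)(x - (e - x0)). *)
apply: (@leq_trans #|pred2 x0 (e - x0)|); last first.
  by rewrite card2; case: (_ != _).
apply: subset_leq_card; apply/fintype.subsetP => x; rewrite !inE -subr_eq0 -hx0 => h.
rewrite -(subr_eq0 x) -(subr_eq0 x (e - x0)) -mulf_eq0 -oppr_eq0.
by move: h; congr (_ == _); ring.
Qed.

(** With the diagonal x, e - x fixed, the off-diagonal entries have product x (e - x) - delta. This
    leaves q - 1 pairs, and q more for the at most two x where that product is zero. *)
Lemma card_det_tr delta e : delta != 0 ->
  (q * q.-1 <= #|[pred A : 'M[F]_2 | (\det A == delta) && (\tr A == e)]|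
   <= q ^ 2 + q)%N.
Proof.
move=> d0; rewrite card_mx4.
have -> : (\sum_x \sum_y \sum_z \sum_t
    [pred A : 'M[F]_2 | (\det A == delta) && (\tr A == e)] (mx4 x y z t) =
    \sum_x (q.-1 + q * ((x * (e - x))%R == delta)))%N.
  apply: eq_bigr => x _; rewrite -[x * _ == _]subr_eq0 -card_mul_eq.
  apply: eq_bigr => y _; apply: eq_bigr => z _.
  rewrite (bigD1 (e - x)) //= [X in (_ + X)%N]big1 ?addn0 => [|t te].
    rewrite det22 tr22 !mxE /= subrKC eqxx andbT; congr nat_of_bool.
    by rewrite -subr_eq0 -[RHS]subr_eq0 -oppr_eq0; congr (_ == _); ring.
  rewrite tr22 !mxE /= andbC; case: eqP => // h.
  by rewrite -h addrAC subrr add0r eqxx in te.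
rewrite big_split /= sum_nat_const leq_addr /= -big_distrr /=.
have := card_quadratic delta e; set k := (\sum_x _)%N => k2.
have q0 : (0 < q)%N by apply/card_gt0P; exists 0.
have -> : (q ^ 2 + q = q * q.-1 + q * 2)%N by move: q0; case: q => // n _; nia.
by rewrite leq_add2l leq_mul2l k2 orbT.
Qed.

(** For e != 0 the off-diagonal entries determine the last one. For e = 0 the last entry is free,
    but the off-diagonal product is -delta, which leaves q - 1 pairs. *)
Lemma card_det_entry delta e : delta != 0 ->
  (#|[pred A : 'M[F]_2 | (\det A == delta) && (A 0%R 0%R == e)]| <= q ^ 2)%N.
Proof.
move=> d0; rewrite card_mx4.
rewrite (bigD1 e) //= [X in (_ + X)%N]big1 ?addn0 => [|x xe]; last first.
  by do 3! apply: big1 => ? _; rewrite !mxE /= (negPf xe) andbF.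
have [->|e0] := eqVneq e 0.
  apply: (@leq_trans (\sum_y \sum_z \sum_(t : F) ((y * z)%R == (- delta)%R))%N).
    apply: leq_sum => y _; apply: leq_sum => z _; apply: leq_sum => t _.
    rewrite det22 !mxE /= eqxx andbT mul0r sub0r.
    by rewrite -[_ * _ == _]eqr_opp opprK.
  under eq_bigr do under eq_bigr do rewrite sum_nat_const.
  under eq_bigr do rewrite -big_distrr.
  rewrite -big_distrr /= card_mul_eq oppr_eq0 (negPf d0) muln0 addn0.
  by rewrite -mulnn leq_mul // leq_pred.
rewrite -mulnn -sum_nat_const; apply: leq_sum => y _.
rewrite -[q]muln1 -sum_nat_const; apply: leq_sum => z _.
rewrite (bigD1 ((delta + y * z) / e)) //= big1 ?addn0 ?leq_b1 // => t te.
rewrite det22 !mxE /= eqxx andbT; case: eqP => // h.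
by rewrite -h subrK mulrC mulKf ?eqxx in te.
Qed.

Lemma card_smx_pred (P : pred 'M[F]_2) :
  #|[pred u : SLt | P (smx u)]| = #|[pred A | (\det A == 1) && P A]|.
Proof.
rewrite -(fintype.card_image (@smx_inj F)); apply: eq_card => A; rewrite !inE.
apply/fintype.imageP/andP => [[u uP ->]|[/eqP/smx_surj[u <-] uP]].
  by rewrite det_smx.
by exists u.
Qed.

Lemma card_SLt : (q ^ 2 * q.-1 <= #|SLt| <= q ^ 3 + q ^ 2)%N.
Proof.
have -> : #|SLt| = (\sum_e #|[pred A : 'M[F]_2 | (\det A == 1%R) && (\tr A == e)]|)%N.
  under eq_bigr do rewrite -(card_smx_pred (fun A => \tr A == _)) -sum1_card.
  by rewrite -sum1_card (partition_big (fun u : SLt => \tr (smx u)) xpredT).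
have b e := card_det_tr e (oner_neq0 F).
apply/andP; split.
  rewrite -mulnn -mulnA -sum_nat_const; apply: leq_sum => e _.
  by case/andP: (b e).
rewrite expnS [(q ^ 2)%N in X in (_ <= _ + X)%N]expnS expn1 -mulnDr -sum_nat_const.
by apply: leq_sum => e _; case/andP: (b e).
Qed.

(** Write V = L D Q with D a partial identity. Then A = Q u L has a fixed non-zero determinant and
    tr (u V) = tr (A D), which is an entry of A in rank 1 and the trace of A in rank 2. *)
Lemma card_SLt_tr_mul V e : V != 0 ->
  (#|[pred u : SLt | \tr (smx u *m V) == e]| <= q ^ 2 + q)%N.
Proof.
move=> V0; pose L := col_ebase V; pose Q := row_ebase V.
have uL : \det L != 0 by rewrite -unitfE -unitmxE col_ebase_unit.
have uQ : \det Q != 0 by rewrite -unitfE -unitmxE row_ebase_unit.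
pose f (u : SLt) := Q *m smx u *m L.
have f_inj : injective f.
  move=> u v /(congr1 (fun B => invmx Q *m B *m invmx L)).
  by rewrite /f !mulmxA mulVmx ?row_ebase_unit // -!mulmxA mulmxV ?col_ebase_unit //
     !mulmx1 !mul1mx => /smx_inj.
have dQL : \det Q * \det L != 0 by rewrite mulf_neq0.
rewrite -(fintype.card_image f_inj).
pose S := [pred A : 'M[F]_2 | (\det A == \det Q * \det L) &&
   (\tr (A *m pid_mx (\rank V)) == e)].
apply: (@leq_trans #|S|).
  apply: subset_leq_card; apply/fintype.subsetP => _ /fintype.imageP[u /= /eqP ue ->].
  rewrite inE /f !det_mulmx det_smx mulr1 eqxx /= -ue -[in eqbRHS](mulmx_ebase V).
  by rewrite -/L -/Q !mulmxA [eqbRHS]mxtrace_mulC !mulmxA.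
have : (0 < \rank V <= 2)%N by rewrite lt0n mxrank_eq0 V0 rank_leq_row.
rewrite {}/S; case: (\rank V) => [|[|[|]]] // _.
  apply: leq_trans (leq_addr _ _); apply: leq_trans (card_det_entry e dQL).
  apply: subset_leq_card; apply/fintype.subsetP => A; rewrite !inE => /andP[->].
  by rewrite tr22 !mxE !sum2 !mxE /= !mulr0 !mulr1 !addr0.
have /andP[_] := card_det_tr e dQL; apply: leq_trans.
by apply: subset_leq_card; apply/fintype.subsetP => A; rewrite !inE pid_mx_1 mulmx1.
Qed.

End Counting.

(** * The trace of a word *)

Section TracePolynomial.
Variables (F : finFieldType) (d : nat).
Local Open Scope ring_scope.

Notation SLt := (subg_of (SL2 F)).
Notation E := (delta_mx 0 1 : 'M[F]_2).

Lemma det_uni (t : F) : \det (1%:M + t *: E) = 1.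
Proof. by rewrite det22 !mxE /=; ring. Qed.

Definition uni (t : F) : SLt := sval (cid (smx_surj (det_uni t))).

Lemma smx_uni t : smx (uni t) = 1%:M + t *: E.
Proof. by rewrite /uni; case: cid. Qed.

Lemma uniV t : (uni t)^-1%g = uni (- t).
Proof.
apply: (mulgI (uni t)); rewrite mulgV; apply: smx_inj.
rewrite smxM !smx_uni smx1.
by apply: matrix22P; rewrite !mxE !sum2 !mxE /=; ring.
Qed.

Implicit Types (C : letter d -> SLt) (a b : letter d) (s : seq (letter d)).

(* A letter a becomes C a * U(+-t) * (C (linv a))^-1, so that consecutive letters
   a, b of a word meet in (C (linv a))^-1 * C b, where linv a != b if the word is
   reduced. *)
Definition curve C (t : F) (i : 'I_d) : SLt :=
  (C (i, false) * uni t * (C (i, true))^-1)%g.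

Definition sgn a : F := (-1) ^+ a.2.

Lemma letter_curve C t a :
  letter_map (curve C t) a = (C a * uni (sgn a * t)%R * (C (linv a))^-1)%g.
Proof.
case: a => i [] /=; rewrite /letter_map /curve /sgn /linv /= ?mul1r //.
by rewrite !invMg invgK uniV expr1 mulN1r mulgA.
Qed.

(** The scalar left at the junction of the letters [a] and [b] when the leading terms are
    multiplied. *)
Definition link C a b : F := smx ((C (linv a))^-1 * C b)%g 1 0.

Definition lead C a : 'M[F]_2 :=
  sgn a *: (smx (C a) *m E *m smx (C (linv a))^-1%g).

Lemma smx_letter_curve C t a : smx (letter_map (curve C t) a) =
  smx (C a * (C (linv a))^-1)%g + t *: lead C a.
Proof.
rewrite letter_curve !smxM smx_uni mulmxDr mulmx1 mulmxDl /lead.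
by rewrite -!scalemxAr -!scalemxAl scalerA mulrC.
Qed.

(** The value of a letter is affine in t; over F[X] the equation in t becomes a question about
    roots. *)
Definition letter_poly C a : 'M[{poly F}]_2 :=
  map_mx polyC (smx (C a * (C (linv a))^-1)%g) + 'X *: map_mx polyC (lead C a).

Definition curve_poly C s := \prod_(a <- s) letter_poly C a.

Lemma horner_curve_poly C s t :
  map_mx (horner_eval t) (curve_poly C s) =
  smx (\prod_(a <- s) letter_map (curve C t) a)%g.
Proof.
rewrite /curve_poly; elim: s => [|a s IHs]; first by rewrite !big_nil map_mx1.
rewrite !big_cons map_mxM smxM IHs smx_letter_curve; congr (_ *m _).
rewrite /letter_poly; move: (smx _) (lead _ _) => M L.
apply/matrixP => i j; rewrite !mxE -[LHS]/(_.[t]).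
by rewrite hornerD hornerM hornerX !hornerC.
Qed.

Lemma size_curve_poly C s i j : (size (curve_poly C s i j) <= (size s).+1)%N.
Proof.
rewrite /curve_poly; elim: s i j => [|a s IHs] i j.
  by rewrite big_nil mxE -polyC_natr size_polyC_leq1.
rewrite big_cons mxE; apply: (leq_trans (size_sum _ _ _)).
apply/bigmax_leqP => l _; apply: (leq_trans (size_polyMleq _ _)).
have szl : (size (letter_poly C a i l) <= 2)%N.
  rewrite /letter_poly; move: (smx _) (lead _ _) => M L.
  rewrite !mxE (leq_trans (size_polyD _ _)) // geq_max.
  rewrite (leq_trans (size_polyC_leq1 _)) //=.
  rewrite (leq_trans (size_polyMleq _ _)) // size_polyX.
  by have := size_polyC_leq1 (L i l); lia.
by have := IHs l j; move: szl => /=; lia.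
Qed.

Lemma coef_curve_poly C s i j :
  (curve_poly C s i j)`_(size s) = (\prod_(a <- s) lead C a) i j.
Proof.
elim: s i j => [|a s IHs] i j.
  by rewrite /curve_poly !big_nil !mxE coefMn coef1.
rewrite /curve_poly !big_cons -/(curve_poly C s) mxE mxE coef_sum /=.
apply: eq_bigr => l _; rewrite !mxE mulrDl coefD coefCM -mulrA coefXM /= coefCM.
(* The constant part of [a] would need the coefficient of degree |s| + 1 in a polynomial of degree
   at most |s|, so only the part with X contributes. *)
by rewrite -IHs [X in _ * X + _]nth_default ?size_curve_poly // mulr0 add0r.
Qed.

(** E has rank one, so it compresses [A] to its lower-left entry. *)
Lemma E_sandwich (A : 'M[F]_2) : E *m A *m E = A 1 0 *: E.
Proof. by apply: matrix22P; rewrite !mxE !sum2 !mxE !sum2 !mxE /=; ring. Qed.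

(** At each junction stands E M E with M = (C (linv a))^-1 C b, which collapses to a [link] times E.
    Only the outer factors survive, and c is a product of signs and links. *)
Lemma prod_lead C a s : path (fun b c => link C b c != 0) a s ->
  exists2 c, c != 0 & \prod_(b <- a :: s) lead C b =
    c *: (smx (C a) *m E *m smx (C (linv (last a s)))^-1%g).
Proof.
have sgn0 b : sgn b != 0 by rewrite signr_eq0.
elim: s a => [|b s IHs] a /=.
  by exists (sgn a) => //; rewrite big_seq1.
case/andP => ab /IHs[c c0 e]; exists (sgn a * c * link C a b).
  by rewrite !mulf_neq0.
rewrite big_cons e /lead.
rewrite -[LHS]/(_ *m _) -scalemxAl -scalemxAr scalerA -[RHS]scalerA.
rewrite /link smxM; 
move: (smx (C a)) (smx (C (linv a))^-1%g) (smx (C b)) => P Q S.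
move: (smx (C (linv (last b s)))^-1%g) => Z.
have -> : P *m E *m Q *m (S *m E *m Z) = P *m (E *m (Q *m S) *m E) *m Z.
  by rewrite !mulmxA.
by rewrite E_sandwich -scalemxAr -scalemxAl.
Qed.

(** By cyclic invariance of the trace the two outer factors meet, and they produce the link from the
    last letter back to the first. *)
Lemma tr_prod_lead C a s : path.cycle (fun b c => link C b c != 0) (a :: s) ->
  \tr (\prod_(b <- a :: s) lead C b) != 0.
Proof.
rewrite /= rcons_path => /andP[/prod_lead[c c0 ->] la].
rewrite mxtraceZ mulf_neq0 //; apply: contra la => /eqP trc0; apply/eqP.
move: trc0; rewrite mxtrace_mulC mulmxA -smxM => <-.
rewrite /link; move: (smx _) => X.
by rewrite tr22 !mxE !sum2 !mxE /=; ring.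
Qed.

Lemma card_curve_trace C a s v : path.cycle (fun b c => link C b c != 0) (a :: s) ->
  (#|[pred t | \tr (smx (\prod_(b <- a :: s) letter_map (curve C t) b)%g) == v]|
   <= (size s).+1)%N.
Proof.
move=> /tr_prod_lead lead0; set S := [pred t | _].
pose p := \tr (curve_poly C (a :: s)) - v%:P.
(* Subtracting v changes only the constant coefficient, whereas the index here is positive. *)
have pk : p`_(size s).+1 != 0.
  rewrite coefB coefC subr0 /mxtrace coef_sum.
  by under eq_bigr do rewrite (coef_curve_poly C (a :: s)).
have p0 : p != 0 by apply: contraNneq pk => ->; rewrite coef0.
have szp : (size p <= (size s).+2)%N.
  rewrite (leq_trans (size_polyD _ _)) // geq_max size_polyN andbC.
  rewrite (leq_trans (size_polyC_leq1 _)) //=.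
  apply: (leq_trans (size_sum _ _ _)); apply/bigmax_leqP => l _.
  exact: (size_curve_poly C (a :: s)).
rewrite cardE -ltnS; apply: leq_trans szp; apply: max_poly_roots => //.
  apply/allP => t; rewrite mem_enum inE => /eqP tv.
  rewrite /root hornerD hornerN hornerC subr_eq0 -tv -horner_curve_poly.
  by rewrite (trace_map_mx (horner_eval t)).
exact: enum_uniq.
Qed.

End TracePolynomial.

(** * Cyclic reduction of words *)

Section CyclicReduction.
Local Open Scope group_scope.
Variable d : nat.
Implicit Types (a b : letter d) (s c : seq (letter d)).

Definition nolinv a b : bool := b != linv a.

Lemma linv_neq a : a != linv a.
Proof. by case: a => i []; rewrite xpair_eqE andbC. Qed.

Lemma letter_map_linv (G : groupType) (x : 'I_d -> G) a :
  letter_map x (linv a) = (letter_map x a)^-1.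
Proof. by case: a => i []; rewrite /letter_map /= ?invgK. Qed.

(** If the first letter is the inverse of the last, stripping both replaces the value by a
    conjugate; induct on the length. The word [c] is chosen before the group and the tuple, only [g]
    depends on them. *)
Lemma cyclic_reduction s : reduced s -> s != [::] ->
  exists c, [/\ c != [::], path.cycle nolinv c &
    forall (G : groupType) (x : 'I_d -> G), exists g,
      \prod_(a <- s) letter_map x a = g * \prod_(a <- c) letter_map x a * g^-1].
Proof.
have [n] := ubnP (size s); elim: n s => // n IHn [//|a s].
case/lastP: s => [|p b] szs red _.
  exists [:: a]; split=> //; first by rewrite /= /nolinv linv_neq.
  by move=> G x; exists 1; rewrite mul1g invg1 mulg1.
have [ab|ab] := eqVneq a (linv b); last first.
  exists (a :: rcons p b); split=> //.
    by rewrite /= rcons_path last_rcons /nolinv ab andbT.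
  by move=> G x; exists 1; rewrite mul1g invg1 mulg1.
have redp : reduced p.
  by move: red; rewrite /reduced /= rcons_path => /andP[/path_sorted].
(* With nothing in the middle the word would be a letter next to its inverse. *)
have p0 : p != [::].
  by apply: contraTneq red => ->; rewrite /reduced /= ab linvK eqxx.
have szp : (size p < n)%N by move: szs; rewrite /= size_rcons; lia.
have [c [c0 cc cx]] := IHn p szp redp p0.
exists c; split=> // G x; have [g gx] := cx G x.
exists (letter_map x a * g).
rewrite big_cons big_rcons /= gx ab letter_map_linv.
by rewrite invMg invgK !mulgA.
Qed.

End CyclicReduction.

(* C(u)^-1 C(v) is uniform because right translation of C(v) acts simply
   transitively on its values. *)
Lemma card_uniform_quotient (L : finType) (T : finGroupType) (u v : L)
    (B : pred T) : u != v ->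
  (#|T| * #|[pred C : {ffun L -> T} | B ((C u)^-1 * C v)%g]| =
   #|{ffun L -> T}| * #|B|)%N.
Proof.
move=> uv; pose sh (h : T) (C : {ffun L -> T}) :=
  [ffun l => if l == v then (C l * h)%g else C l].
have shK h : cancel (sh h) (sh h^-1%g).
  by move=> C; apply/ffunP => l; rewrite !ffunE; case: (l == v); rewrite ?mulgK.
rewrite -sum_nat_const.
transitivity (\sum_(h : T) \sum_(C : {ffun L -> T}) B ((C u)^-1 * C v * h)%g)%N.
  apply: eq_bigr => h _; rewrite -sum1_card big_mkcond /=.
  rewrite (reindex_inj (can_inj (shK h))) /=; apply: eq_bigr => C _.
  by rewrite inE !ffunE eqxx (negPf uv) mulgA; case: (B _).
rewrite exchange_big -sum_nat_const; apply: eq_bigr => C _ /=.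
by rewrite -sum1_card [RHS]big_mkcond /= [RHS](reindex_inj (mulgI ((C u)^-1 * C v)%g)).
Qed.

(** * Distribution of the trace of a word *)

Section TraceBound.
Variables (F : finFieldType) (d : nat).

Notation SLt := (subg_of (SL2 F)).
Notation q := #|F|.
Notation LC := {ffun letter d -> SLt}.
Implicit Types (a b : letter d) (s c : seq (letter d)).

Lemma card_field_gt1 : (1 < q)%N.
Proof.
by rewrite (cardD1 (0%R : F)) (cardD1 (1%R : F)) !inE oner_eq0 add1n.
Qed.

Lemma card_link a b : nolinv a b ->
  (q * #|[pred C : LC | link C a b == 0%R]| <= 3 * #|LC|)%N.
Proof.
move=> ab; have ab' : linv a != b by rewrite eq_sym.
have := card_uniform_quotient [pred u : SLt | smx u 1%R 0%R == 0%R] ab'.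
rewrite -[X in (#|_| * X)%N]/#|[pred C : LC | link C a b == 0%R]|.
have V0 : (delta_mx 0 1 : 'M[F]_2)%R != 0%R.
  by apply/eqP => /matrixP/(_ 0%R 1%R)/eqP; rewrite !mxE /= oner_eq0.
have := card_SLt_tr_mul 0%R V0; have /andP[cS _] := card_SLt F.
have -> : #|[pred u : SLt | (\tr (smx u *m delta_mx 0 1) == 0)%R]| =
          #|[pred u : SLt | smx u 1%R 0%R == 0%R]|.
  apply: eq_card => u; rewrite !inE tr22 !mxE !sum2 !mxE /=.
  by rewrite !mulr0 mulr1 !add0r addr0.
set m := #|[pred C : LC | _]|; set B := #|[pred u : SLt | _]|; set N := #|LC| => hB e.
have q1 := card_field_gt1.
have : (q ^ 2 * q.-1 * m <= N * (q ^ 2 + q))%N.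
  by rewrite (leq_trans (leq_mul cS (leqnn m))) // e leq_mul2l hB orbT.
move: q1; case: q => // -[//|n] _ /= h.
have : (n.+2 * n.+1 * (n.+2 * m) <= n.+2 * n.+1 * (3 * N))%N by nia.
by rewrite leq_pmul2l // muln_gt0.
Qed.

(** Union bound over the junctions. *)
Lemma card_bad_path a s : path (@nolinv d) a s ->
  (q * #|[pred C : LC | ~~ path (fun b b' => link C b b' != 0%R) a s]| <=
   3 * size s * #|LC|)%N.
Proof.
elim: s a => [|b s IHs] a /=.
  by rewrite [X in (q * X)%N]eq_card0 ?muln0.
case/andP => ab /IHs bs.
have := card_link ab; set X := [pred C : LC | link C a b == 0%R].
move: bs; set Y := [pred C : LC | _]; set Z := [pred C : LC | _] => hY hX.
have : (#|Z| <= #|X| + #|Y|)%N.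
  rewrite -cardUI; apply: leq_trans (leq_addr _ _).
  apply: subset_leq_card; apply/fintype.subsetP => C.
  by rewrite !inE negb_and negbK.
move=> h; apply: (leq_trans (leq_mul (leqnn q) h)).
by rewrite mulnDr mulnS mulnDl leq_add.
Qed.

(* For fixed t the tuple curve C t is uniform: left translation of the entries
   C (i, false) translates it. *)
Lemma card_curve (t : F) (P : pred {ffun 'I_d -> SLt}) :
  (#|SLt| ^ d * #|[pred C : LC | P [ffun i => curve C t i]]| = #|LC| * #|P|)%N.
Proof.
pose sh (y : {ffun 'I_d -> SLt}) (C : LC) : LC :=
  [ffun a => if a.2 then C a else (y a.1 * C a)%g].
have shK y : cancel (sh y) (sh [ffun i => (y i)^-1%g]).
  by move=> C; apply/ffunP => -[i []]; rewrite !ffunE //= mulKg.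
rewrite -[X in (#|_| ^ X)%N](card_ord d) -card_ffun -!sum_nat_const.
transitivity (\sum_(y : {ffun 'I_d -> SLt}) \sum_(C : LC)
   P [ffun i => y i * curve C t i]%g)%N.
  apply: eq_bigr => y _; rewrite -sum1_card big_mkcond /=.
  rewrite (reindex_inj (can_inj (shK y))) /=; apply: eq_bigr => C _.
  rewrite inE; set z := finfun _; set z' := finfun _.
  have -> : z = z' by apply/ffunP => i; rewrite !ffunE /curve !ffunE /= !mulgA.
  by case: (P _).
rewrite exchange_big; apply: eq_bigr => C _ /=.
rewrite -sum1_card [RHS]big_mkcond /=.
pose r (y : {ffun 'I_d -> SLt}) := [ffun i => y i * curve C t i]%g.
have rI : injective r.
  move=> y y' /ffunP yy; apply/ffunP => i.
  by have := yy i; rewrite !ffunE => /mulIg.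
by rewrite [RHS](reindex_inj rI).
Qed.

(** Count pairs (t, C). If all links of [C] are non-zero, at most k parameters t give the trace v;
    the other [C] have proportion at most 3k/q and each has at most q parameters. Since [curve C t]
    is uniform for every t, the total 3k + k gives the constant 4. *)
Lemma card_word_trace_cyclic c (v : F) : c != [::] -> path.cycle (@nolinv d) c ->
  (q * #|[pred x : {ffun 'I_d -> SLt} |
          \tr (smx (\prod_(a <- c) letter_map x a)%g) == v]%R|
   <= 4 * size c * #|SLt| ^ d)%N.
Proof.
case: c => // a s _ cyc; set P := [pred x | _]; set k := size (a :: s).
pose good (C : LC) := path.cycle (fun b b' => link C b b' != 0%R) (a :: s).
have N0 : (0 < #|LC|)%N by apply/card_gt0P; exists [ffun=> 1%g].
have bad : (q * #|[pred C | ~~ good C]| <= 3 * k * #|LC|)%N.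
  (* A cycle on a :: s is a path from a along rcons s a, so the closing junction is included and
     there are exactly k junctions. *)
  have := card_bad_path (s := rcons s a) (a := a).
  by rewrite size_rcons; apply.
have : (\sum_(t : F) #|[pred C : LC | P [ffun i => curve C t i]]| <=
        4 * k * #|LC|)%N.
  apply: (@leq_trans (\sum_(C : LC) ((~~ good C) * q + k))%N).
    under eq_bigr do rewrite -sum1_card big_mkcond /=.
    rewrite exchange_big; apply: leq_sum => C _ /=.
    rewrite -big_mkcond sum1_card.
    case: (boolP (good C)) => /= gC; last first.
      by rewrite mul1n; apply: leq_trans (max_card _) (leq_addr _ _).
    rewrite add0n; apply: leq_trans (card_curve_trace v gC).
    apply: subset_leq_card; apply/fintype.subsetP => t; rewrite !inE.
    have e : letter_map (curve C t) =1 letter_map [ffun i => curve C t i].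
      by move=> b; rewrite /letter_map !ffunE.
    by rewrite (eq_bigr _ (fun b _ => e b)).
  rewrite big_split sum_nat_const /= -big_distrl /= mulnC.
  have -> : (\sum_(C : LC) ~~ good C = #|[pred C | ~~ good C]|)%N.
    by rewrite -sum1_card [RHS]big_mkcond.
  apply: leq_trans (leq_add bad (leqnn _)) _.
  by rewrite [(_ * k)%N in X in (_ + X <= _)%N]mulnC -mulnDl -mulSnr.
move=> h; rewrite -(leq_pmul2l N0) mulnCA -sum_nat_const.
under eq_bigr => t _ do rewrite -(card_curve t).
by rewrite -big_distrr /= mulnA [leqRHS]mulnC leq_mul2l [(#|LC| * _)%N]mulnC h orbT.
Qed.

End TraceBound.

(** A word and its cyclic reduction have conjugate values, hence equal traces. The constant depends
    on the word alone, which makes the bound uniform in the field. *)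
Lemma card_word_trace d (w : free_group d) : w <> 1%g ->
  exists K : nat, forall (F : finFieldType) (v : F),
  (#|F| * #|[set x : {ffun 'I_d -> subg_of (SL2 F)} |
             \tr (smx (word_map w x)) == v]%R| <= K * #|subg_of (SL2 F)| ^ d)%N.
Proof.
move=> w1; have w0 : letters w != [::].
  by apply/eqP => w0; apply: w1; apply: val_inj.
have [c [c0 cyc cx]] := cyclic_reduction (letters_reduced w) w0.
exists (4 * size c)%N => F v; apply: leq_trans (card_word_trace_cyclic v c0 cyc).
rewrite leq_mul2l; apply/orP; right; apply: subset_leq_card.
apply/fintype.subsetP => x; rewrite !inE.
have [g gx] := cx _ x; rewrite /word_map gx !smxM mxtrace_mulC mulmxA -smxM.
by rewrite mulVg mul1mx.
Qed.

(** * Non-scalar elements *)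

Section Regular.
Variable F : finFieldType.
Local Open Scope ring_scope.

Notation SLt := (subg_of (SL2 F)).
Notation q := #|F|.
Implicit Types (A B P V : 'M[F]_2) (u g a b : SLt).

(** For 2 x 2 matrices this means non-scalar, in an entrywise form suited to case analysis. *)
Definition regular A :=
  [|| A 0 1 != 0, A 1 0 != 0 | A 0 0 != A 1 1].

Definition sreg u := regular (smx u).

Lemma not_regular A : ~~ regular A -> A = (A 0 0)%:M.
Proof.
rewrite /regular !negb_or !negbK => /and3P[/eqP a01 /eqP a10 /eqP a11].
by apply: matrix22P; rewrite !mxE /= ?mulr1n ?mulr0n ?a01 ?a10 -?a11.
Qed.

Lemma regular_scale A (c : F) : c != 0 -> regular (c *: A) = regular A.
Proof.
move=> c0.
by rewrite /regular !mxE !mulf_eq0 (negPf c0) /= (inj_eq (mulfI c0)).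
Qed.

Lemma sreg_scalar u : ~~ sreg u -> exists2 c, c != 0 & smx u = c%:M.
Proof.
move=> /not_regular uc; exists (smx u 0 0) => //.
apply: contraTneq (oner_neq0 F) => c0; rewrite -(det_smx u) uc c0.
by rewrite -scalemx1 scale0r det0 // eqxx.
Qed.

Lemma sregMl a g : ~~ sreg a -> sreg (a * g)%g = sreg g.
Proof.
by case/sreg_scalar => c c0 ac; rewrite /sreg smxM ac mul_scalar_mx regular_scale.
Qed.

Lemma sregMr a g : ~~ sreg g -> sreg (a * g)%g = sreg a.
Proof.
by case/sreg_scalar => c c0 gc; rewrite /sreg smxM gc mul_mx_scalar regular_scale.
Qed.

Lemma sregV u : sreg u^-1%g = sreg u.
Proof.
have sub v : sreg v -> sreg v^-1%g.
  apply: contraTT => vr; rewrite -(sregMl v vr) mulVg.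
  by rewrite /sreg smx1 /regular !mxE !eqxx.
by apply/idP/idP => /sub //; rewrite invgK.
Qed.

Lemma card_not_sreg : (#|[pred u | ~~ sreg u]| <= 2)%N.
Proof.
(* A scalar c of determinant 1 satisfies c^2 = 1, written c (0 - c) = -1 to fit the quadratic
   count. *)
apply: leq_trans (card_quadratic (-1) (0 : F)).
have -> : (\sum_(x : F) ((x * (0 - x))%R == (-1)%R) =
          #|[pred x : F | (x * (0 - x))%R == (-1)%R]|)%N.
  by rewrite -sum1_card [RHS]big_mkcond.
pose f u := smx u 0 0.
have fI : {in [pred u | ~~ sreg u] &, injective f}.
  move=> u v; rewrite !inE => /not_regular uc /not_regular vc uv.
  by apply: smx_inj; rewrite uc vc -/(f u) uv.
rewrite -(card_in_imset fI); apply: subset_leq_card.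
apply/fintype.subsetP => _ /imsetP[u ur ->]; rewrite !inE in ur *.
have := det_smx u; rewrite (not_regular ur) det22 !mxE /= mulr1n mulr0n /f => <-.
by apply/eqP; ring.
Qed.

(* The rows of P are a cyclic vector (x, y) and its image under A. *)
Lemma conj_companion A : regular A -> exists2 P, \det P != 0 &
  P *m A = mx4 0 1 (- \det A) (\tr A) *m P.
Proof.
have comp x y : mx4 x y (x * A 0 0 + y * A 1 0) (x * A 0 1 + y * A 1 1) *m A =
  mx4 0 1 (- \det A) (\tr A) *m
  mx4 x y (x * A 0 0 + y * A 1 0) (x * A 0 1 + y * A 1 1).
  by rewrite det22 tr22; apply: matrix22P; rewrite !mxE !sum2 !mxE /=; ring.
(* The cyclic row vector is (1, 0) if A 0 1 != 0, (0, 1) if A 1 0 != 0, and (1, 1) if A is diagonal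
   with distinct entries. *)
move=> Ar; have [a01|a01] := eqVneq (A 0 1) 0; last first.
  exists (mx4 1 0 (1 * A 0 0 + 0 * A 1 0) (1 * A 0 1 + 0 * A 1 1)) => //.
  by rewrite det22 !mxE /= !mul1r !mul0r subr0 addr0.
have [a10|a10] := eqVneq (A 1 0) 0; last first.
  exists (mx4 0 1 (0 * A 0 0 + 1 * A 1 0) (0 * A 0 1 + 1 * A 1 1)) => //.
  by rewrite det22 !mxE /= !mul1r !mul0r sub0r add0r oppr_eq0.
move: Ar; rewrite /regular a01 a10 !eqxx /= => a00.
exists (mx4 1 1 (1 * A 0 0 + 1 * A 1 0) (1 * A 0 1 + 1 * A 1 1)) => //.
by rewrite det22 !mxE /= a01 a10 !mul1r addr0 add0r subr_eq0 eq_sym.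
Qed.

Lemma smx_conj P : \det P != 0 -> exists2 phi : SLt -> SLt,
  {morph phi : u v / (u * v)%g} & forall u, P *m smx u = smx (phi u) *m P.
Proof.
move=> dP; have uP : P \in unitmx by rewrite unitmxE unitfE.
have dc u : \det (P *m smx u *m invmx P) = 1.
  by rewrite !det_mulmx det_smx mulr1 -det_mulmx mulmxV // det1.
pose phi u := sval (cid (smx_surj (dc u))).
have phiE u : smx (phi u) = P *m smx u *m invmx P by rewrite /phi; case: cid.
exists phi => [u v|u]; last by rewrite phiE mulmxKV.
by apply: smx_inj; rewrite smxM !phiE smxM !mulmxA mulmxKV.
Qed.

(** Both elements are conjugate in GL_2 to the companion matrix of their common trace. The resulting
    conjugation of SL_2 takes u to v and, applied coordinatewise, matches the solutions. *)
Lemma nb_sol_regular d (w : free_group d) u v :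
  sreg u -> sreg v -> \tr (smx u) = \tr (smx v) -> nb_sol w u = nb_sol w v.
Proof.
move=> /conj_companion[P dP Pu] /conj_companion[Q dQ Qv] uv.
have uQ : Q \in unitmx by rewrite unitmxE unitfE.
rewrite det_smx uv in Pu; rewrite det_smx in Qv.
move: Pu Qv; move: (mx4 _ _ _ _) => X Pu Qv.
have dQP : \det (invmx Q *m P) != 0.
  by rewrite det_mulmx det_inv mulf_neq0 // invr_eq0.
have [phi phiM phiE] := smx_conj dQP.
have uQP : invmx Q *m P \in unitmx by rewrite unitmxE unitfE.
have phi_inj : injective phi.
  move=> a b ab; apply: smx_inj; have := phiE a; rewrite ab -phiE.
  by move/(congr1 (mulmx (invmx (invmx Q *m P)))); rewrite !mulKmx.
have -> : v = phi u.
  apply: smx_inj; rewrite -[RHS](mulmxK uQP) -phiE -[invmx Q *m P *m _]mulmxA Pu.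
  rewrite -[smx v](mulKmx uQ) Qv.
have -> : invmx Q *m (X *m P) = invmx Q *m (X *m Q) *m (invmx Q *m P).
    by rewrite !mulmxA mulmxK.
  by rewrite mulmxK.
rewrite !nb_solE; pose Phi (x : {ffun 'I_d -> SLt}) := [ffun i => phi (x i)].
have PhiI : injective Phi.
  move=> x y /ffunP xy; apply/ffunP => i; have := xy i; rewrite !ffunE.
  exact: phi_inj.
rewrite [RHS](reindex_inj PhiI) /=; apply: eq_bigr => x _.
rewrite -(inj_eq phi_inj) (word_map_morph _ _ phiM); congr (nat_of_bool (_ == _)).
by apply: eq_bigr => a _; rewrite /letter_map !ffunE.
Qed.

(** After V 1 1 = - V 0 0 the second condition is linear in three entries, with coefficients that do
    not all vanish because [g] is not scalar. One entry is therefore determined by the other two. *)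
Lemma card_traceless_orthogonal g : sreg g ->
  (#|[pred V : 'M[F]_2 | (\tr V == 0)%R && (\tr (V *m smx g) == 0)%R]| <= q ^ 2)%N.
Proof.
rewrite /sreg; move: (smx g) => A Ar; set S := [pred V | _].
have SE V : V \in S -> V 1 1 = - V 0 0 /\
    V 0 0 * (A 0 0 - A 1 1) + V 0 1 * A 1 0 + V 1 0 * A 0 1 = 0.
  rewrite inE !tr22 !mxE !sum2 => /andP[/eqP v1 /eqP v2].
  have v11 : V 1 1 = - V 0 0 by apply/eqP; rewrite -addr_eq0 addrC v1.
  by split=> //; rewrite -[RHS]v2 v11; ring.
have inj (f : 'M[F]_2 -> F * F) : {in S &, injective f} -> (#|S| <= q ^ 2)%N.
  by move=> fI; rewrite -mulnn -card_prod; apply: leq_card_in fI.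
have [a01|a01] := eqVneq (A 0 1) 0; last first.
  apply: (inj (fun V => (V 0 0, V 0 1))) => V W /SE[v1 v2] /SE[w1 w2] [e1 e2].
  apply: matrix22P => //; last by rewrite v1 w1 e1.
  by apply: (mulIf a01); apply: (addrI (V 0 0 * (A 0 0 - A 1 1) + V 0 1 * A 1 0));
    rewrite v2 e1 e2 w2.
have [a10|a10] := eqVneq (A 1 0) 0; last first.
  apply: (inj (fun V => (V 0 0, V 1 0))) => V W /SE[v1 v2] /SE[w1 w2] [e1 e2].
  apply: matrix22P => //; last by rewrite v1 w1 e1.
  by move: v2 w2; rewrite a01 !mulr0 !addr0 e1 => <- /addrI/(mulIf a10) ->.
have a00 : A 0 0 - A 1 1 != 0.
  by move: Ar; rewrite /regular a01 a10 !eqxx subr_eq0.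
apply: (inj (fun V => (V 0 1, V 1 0))) => V W /SE[v1 v2] /SE[w1 w2] [e1 e2].
have e0 : V 0 0 = W 0 0.
  by move: v2 w2; rewrite a01 a10 !mulr0 !addr0 => <- /(mulIf a00) ->.
by apply: matrix22P => //; rewrite v1 w1 e0.
Qed.

Definition nb_traces g (s t : F) :=
  #|[pred a | (\tr (smx a) == s) && (\tr (smx a *m smx g) == t)]|.

(** Polarization of the quadratic form det; (tr A) I - A is the adjugate of A. *)
Lemma detD22 A V :
  \det (A + V) = \det A + \tr (((\tr A)%:M - A) *m V) + \det V.
Proof. by rewrite !det22 !tr22 !mxE !sum2 !mxE /= ?mulr1n ?mulr0n; ring. Qed.

Lemma sum_nb_traces g : (\sum_s \sum_t nb_traces g s t = #|SLt|)%N.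
Proof.
rewrite -sum1_card (partition_big (fun u : SLt => \tr (smx u)) xpredT) //=.
apply: eq_bigr => s _.
rewrite (partition_big (fun u : SLt => \tr (smx u *m smx g)) xpredT) //=.
by apply: eq_bigr => t _; rewrite sum1_card.
Qed.

(* The left-hand side counts the pairs (a, b) with tr a = tr b and
   tr ag = tr bg.  Put V = b - a: then V lies in a plane, and det b = 1 becomes
   the affine condition tr (a^-1 V) = - det V on a. *)
Lemma sum_sqr_nb_traces g : sreg g ->
  (\sum_s \sum_t nb_traces g s t ^ 2 <= #|SLt| + q ^ 2 * (q ^ 2 + q))%N.
Proof.
move=> gr; pose S := [pred V : 'M[F]_2 | (\tr V == 0) && (\tr (V *m smx g) == 0)].
pose c V := #|[pred a | \det (smx a + V) == 1]|.
have c0 : c 0 = #|SLt|.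
  by apply: eq_card => a; rewrite !inE addr0 det_smx eqxx.
have cV V : V != 0 -> (c V <= q ^ 2 + q)%N.
  move=> V0; apply: leq_trans (card_SLt_tr_mul (- \det V) V0).
  rewrite /c -(fintype.card_image (@invg_inj SLt)); apply: subset_leq_card.
  apply/fintype.subsetP => _ /fintype.imageP[a /= ac ->]; move: ac; rewrite !inE.
  rewrite smxV detD22 det_smx -addrA -subr_eq0 addrAC subrr add0r => h.
  by rewrite -addr_eq0.
(* V = 0 stands for the pairs with a = b and contributes |G|; the others are at most q^2 in number
   and contribute at most q^2 + q each. *)
apply: (@leq_trans (\sum_(V | S V) c V)%N); last first.
  rewrite (bigD1 0) /=; last by rewrite mul0mx mxtrace0 eqxx.
  rewrite c0 leq_add2l; apply: (@leq_trans (\sum_(V | S V) (q ^ 2 + q))%N).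
    rewrite [leqRHS](bigD1 0) /=; last by rewrite mul0mx mxtrace0 eqxx.
    apply: leq_trans (leq_addl _ _); apply: leq_sum => V /andP[_ V0]; exact: cV.
  by rewrite sum_nat_const leq_mul2r; apply/orP; right; apply: card_traceless_orthogonal.
have -> : (\sum_s \sum_t nb_traces g s t ^ 2 =
    \sum_a nb_traces g (\tr (smx a)) (\tr (smx a *m smx g)))%N.
  rewrite [RHS](partition_big (fun u : SLt => \tr (smx u)) xpredT) //=.
  apply: eq_bigr => s _.
  rewrite [RHS](partition_big (fun u : SLt => \tr (smx u *m smx g)) xpredT) //=.
  apply: eq_bigr => t _; rewrite -mulnn -sum_nat_const.
  apply: eq_big => [a|a]; first by rewrite inE.
  by rewrite inE => /andP[/eqP-> /eqP->].
have -> : (\sum_(V | S V) c V =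
    \sum_a #|[pred V | S V && (\det (smx a + V) == 1%R)]|)%N.
  under eq_bigr do rewrite /c -sum1_card big_mkcond /=.
  rewrite exchange_big /=; apply: eq_bigr => a _.
  by rewrite -big_mkcondr sum1_card; apply: eq_card => V; rewrite !inE.
apply: leq_sum => a _; pose f b := smx b - smx a.
have f_inj : injective f by move=> b b' /addIr/smx_inj.
rewrite /nb_traces -(fintype.card_image f_inj); apply: subset_leq_card.
apply/fintype.subsetP => _ /fintype.imageP[b /= br ->].
move: br; rewrite !inE /= => /andP[/eqP br /eqP bg].
by rewrite /f mulmxBl !raddfB /= br bg !subrr eqxx subrKC det_smx eqxx.
Qed.

End Regular.

(** * The numerical estimate behind the collision bound *)

Section NumericBound.
Local Open Scope ring_scope.

(** Here x, rho, k stand for q, q^(1/2), K. The outer factor bounds |G|; in the bracket, the first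
    two terms bound the convolution at non-scalar elements and the last one the squares at the two
    scalar ones. The excess over 1 is at most (12 + 40 + 36) k^4 / rho. *)
Lemma conv_numeric_bound (R : realFieldType) (x rho k : R) :
  4 <= x -> 0 < rho -> rho ^+ 2 = x -> 1 <= k ->
  (x ^+ 3 + x ^+ 2) * (x / (x ^+ 2 - x - 2) ^+ 2 + 20 * k ^+ 2 * rho / x ^+ 4 +
    2 * (2 * k / x ^+ 3 + 2 * (k / x) ^+ 2) ^+ 2) <= 1 + 100 * k ^+ 4 / rho.
Proof.
move=> x4 rho0 rr k1.
have x0 : 0 < x by lra.
have k0 : 0 < k by lra.
have rho1 : 1 <= rho by rewrite leNgt; apply/negP => h; nra.
have k2 : 1 <= k ^+ 2 by rewrite exprn_ege1.
have k24 : k ^+ 2 <= k ^+ 4 by rewrite ler_weXn2l.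
have k4 : 1 <= k ^+ 4 by lra.
have xV : x^-1 <= rho^-1 by rewrite lef_pV2 ?posrE // -rr expr2 ler_peMr // ltW.
have rhoV : 0 < rho^-1 by rewrite invr_gt0.
have x3 : x ^+ 3 + x ^+ 2 <= 2 * x ^+ 3.
  have : 0 <= x ^+ 2 * (x - 1) by rewrite mulr_ge0 ?sqr_ge0; lra.
  by lra.
have t1 : (x ^+ 3 + x ^+ 2) * (x / (x ^+ 2 - x - 2) ^+ 2) <= 1 + 12 * x^-1.
  have p0 : 0 < (x - 2) ^+ 2 * (x + 1) by rewrite mulr_gt0 ?exprn_gt0; lra.
  (* Cancellation through x^2 - x - 2 = (x - 2)(x + 1). *)
  have -> : (x ^+ 3 + x ^+ 2) * (x / (x ^+ 2 - x - 2) ^+ 2) =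
      x ^+ 3 / ((x - 2) ^+ 2 * (x + 1)).
    by field; apply/and3P; split; apply/eqP; nra.
  rewrite ler_pdivrMr //.
  have -> : (1 + 12 * x^-1) * ((x - 2) ^+ 2 * (x + 1)) =
      x ^+ 3 + (9 * x ^+ 2 * (x - 4) + 4 * x + 48) * x^-1.
    by field; rewrite lt0r_neq0.
  rewrite lerDl; apply: mulr_ge0; last by rewrite invr_ge0 ltW.
  have : 0 <= x ^+ 2 * (x - 4) by apply: mulr_ge0; rewrite ?sqr_ge0 // subr_ge0.
  by clear -x4; lra.
have t2 : (x ^+ 3 + x ^+ 2) * (20 * k ^+ 2 * rho / x ^+ 4) <= 40 * k ^+ 4 * rho^-1.
  apply: (@le_trans _ _ (2 * x ^+ 3 * (20 * k ^+ 4 * rho / x ^+ 4))).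
    rewrite ler_pM ?addr_ge0 ?exprn_ge0 ?divr_ge0 ?mulr_ge0 ?exprn_ge0 //
      ?(ltW x0) ?(ltW rho0) ?(ltW k0) //.
    rewrite ler_wpM2r ?invr_ge0 ?exprn_ge0 ?(ltW x0) // ler_wpM2r ?(ltW rho0) //.
    lra.
  by rewrite le_eqVlt -{1 2}rr; apply/orP; left; apply/eqP; field; rewrite lt0r_neq0.
have t3 : (x ^+ 3 + x ^+ 2) * (2 * (2 * k / x ^+ 3 + 2 * (k / x) ^+ 2) ^+ 2)
   <= 36 * k ^+ 4 * x^-1.
  have b0 : 0 <= 2 * k / x ^+ 3 + 2 * (k / x) ^+ 2.
    apply: addr_ge0; last by rewrite mulr_ge0 ?sqr_ge0.
    by rewrite divr_ge0 ?exprn_ge0 ?(ltW x0) // mulr_ge0 // ltW.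
  have b3 : 2 * k / x ^+ 3 + 2 * (k / x) ^+ 2 <= 3 * k ^+ 2 / x ^+ 2.
    have -> : 2 * k / x ^+ 3 + 2 * (k / x) ^+ 2 = (2 * k / x + 2 * k ^+ 2) / x ^+ 2.
      by field; rewrite lt0r_neq0.
    rewrite ler_wpM2r ?invr_ge0 ?exprn_ge0 ?(ltW x0) //.
    have : 2 * k / x <= k by rewrite ler_pdivrMr //; nra.
    nra.
  have b2 : (2 * k / x ^+ 3 + 2 * (k / x) ^+ 2) ^+ 2 <= (3 * k ^+ 2 / x ^+ 2) ^+ 2.
    by rewrite lerXn2r // nnegrE // (le_trans b0).
  apply: (@le_trans _ _ (2 * x ^+ 3 * (2 * (3 * k ^+ 2 / x ^+ 2) ^+ 2))).
    by rewrite ler_pM ?addr_ge0 ?exprn_ge0 ?mulr_ge0 ?sqr_ge0 ?(ltW x0) // ler_wpM2l.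
  by rewrite le_eqVlt; apply/orP; left; apply/eqP; field; rewrite lt0r_neq0.
have t4 : k ^+ 4 * x^-1 <= k ^+ 4 * rho^-1 by rewrite ler_wpM2l // (le_trans _ k4).
have t5 : rho^-1 <= k ^+ 4 * rho^-1 by rewrite ler_peMl // ltW.
rewrite mulrDr [X in X + _ <= _]mulrDr.
by move: t1 t2 t3 t4 t5 xV; lra.
Qed.
End NumericBound.

(** * The convolution of two class functions *)

Section Convolution.
Variables (R : realType) (F : finFieldType).
Local Open Scope ring_scope.

Notation SLt := (subg_of (SL2 F)).
Notation q := (#|F|%:R : R).
Notation r := (Num.sqrt (#|F|%:R : R)).
Implicit Types (u v g a b : SLt) (e : F) (p : SLt -> R).

(** Expanding the squares gives sum N^2 - 2 q |G| + q^4. With q^3 - q^2 <= |G| <= q^3 + q^2 the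
    terms in q^4 cancel. *)
Lemma sum_dev_traces g : sreg g ->
  \sum_s \sum_t ((nb_traces g s t)%:R - q) ^+ 2 <= 5 * q ^+ 3.
Proof.
move=> gr; have := sum_sqr_nb_traces gr; have := sum_nb_traces g.
have /andP[lo up] := card_SLt F; set n := #|SLt| in lo up *.
move=> /(congr1 (fun k : nat => k%:R : R)) s1.
rewrite -(ler_nat R) natrD => s2.
have q1 : 1 <= q by rewrite ler1n (ltnW (card_field_gt1 F)).
have lo' : q ^+ 3 - q ^+ 2 <= n%:R.
  apply: le_trans (_ : (#|F| ^ 2 * #|F|.-1)%:R <= _); last by rewrite ler_nat.
  by rewrite natrM natrX -subn1 natrB ?(ltnW (card_field_gt1 F)) //; lra.
have up' : n%:R <= q ^+ 3 + q ^+ 2.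
  by rewrite -!natrX -natrD ler_nat.
have -> : \sum_s \sum_t ((nb_traces g s t)%:R - q) ^+ 2 =
  (\sum_s \sum_t nb_traces g s t ^ 2)%N%:R
  - 2 * q * (\sum_s \sum_t nb_traces g s t)%N%:R + q ^+ 4.
  rewrite !natr_sum mulr_sumr -sumrB.
  have -> : q ^+ 4 = \sum_(s : F) \sum_(t : F) q ^+ 2.
    by rewrite !sumr_const -mulrnA -[_ *+ (_ * _)]mulr_natr natrM -expr2 -exprD.
  rewrite -big_split; apply: eq_bigr => s _ /=.
  rewrite !natr_sum mulr_sumr -sumrB -big_split; apply: eq_bigr => t _ /=.
  by rewrite natrX; ring.
rewrite s1; move: s2; rewrite natrM natrD !natrX => s2.
have : q ^+ 2 <= q ^+ 3 by rewrite ler_eXn2l // ?ltr1n ?card_field_gt1.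
have : q * (q ^+ 3 - q ^+ 2) <= q * n%:R by rewrite ler_wpM2l // (le_trans ler01).
by move: s2 up'; nra.
Qed.

Lemma sum_absdev_traces g : sreg g ->
  \sum_s \sum_t `|(nb_traces g s t)%:R - q| <= 3 * q ^+ 2 * r.
Proof.
move=> gr; have q0 : 0 < q by rewrite ltr0n (ltnW (card_field_gt1 F)).
have r0 : 0 < r by rewrite sqrtr_gt0.
have rr : r ^+ 2 = q by rewrite sqr_sqrtr // ltW.
move: r0 rr; move: (Num.sqrt q) => rho r0 rr.
(* AM-GM with weight q^(1/2) takes the place of Cauchy-Schwarz; summed over the q^2 pairs it gives
   5/2 + 1/2 = 3. *)
have amgm (x : R) : `|x| <= x ^+ 2 * (2 * rho)^-1 + rho / 2.
  have -> : x ^+ 2 * (2 * rho)^-1 + rho / 2 = (`|x| ^+ 2 + rho ^+ 2) / (2 * rho).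
    by rewrite real_normK ?num_real //; field; rewrite lt0r_neq0.
  rewrite ler_pdivlMr ?mulr_gt0 //; have := sqr_ge0 (`|x| - rho); nra.
apply: (@le_trans _ _ (\sum_s \sum_t
   (((nb_traces g s t)%:R - q) ^+ 2 * (2 * rho)^-1 + rho / 2))).
  by apply: ler_sum => s _; apply: ler_sum.
under eq_bigr do rewrite big_split -mulr_suml sumr_const.
rewrite big_split -mulr_suml sumr_const /= -mulrnA -[_ *+ (_ * _)]mulr_natr natrM.
have := sum_dev_traces gr; set D := \sum_s _ => hD.
have : D * (2 * rho)^-1 <= 5 * q ^+ 3 * (2 * rho)^-1.
  by rewrite ler_wpM2r // invr_ge0 ltW // mulr_gt0.
have -> : 5 * q ^+ 3 * (2 * rho)^-1 = 5 / 2 * q ^+ 2 * rho.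
  by rewrite -rr; field; rewrite lt0r_neq0.
by move: (D * _) => E hE; nra.
Qed.

Lemma den_gt0 (x : R) : 4 <= x -> 0 < x ^+ 2 - x - 2.
Proof. by move=> x4; nra. Qed.

(** What the convolution argument needs to know about a word distribution on SL_2(q). *)
Definition class_distr (K : R) p := [/\ forall u, 0 <= p u, \sum_u p u = 1,
  (forall u v, sreg u -> sreg v -> \tr (smx u) = \tr (smx v) -> p u = p v) &
  forall e, \sum_(u | \tr (smx u) == e) p u <= K / q].

Lemma det_companion e : \det (mx4 0 1 (-1) e : 'M[F]_2) = 1.
Proof. by rewrite det22 !mxE /=; ring. Qed.

Definition companion e : SLt := sval (cid (smx_surj (det_companion e))).

Lemma smx_companion e : smx (companion e) = mx4 0 1 (-1) e.
Proof. by rewrite /companion; case: cid. Qed.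

Lemma sreg_companion e : sreg (companion e).
Proof. by rewrite /sreg smx_companion /regular !mxE /= oner_eq0. Qed.

Lemma tr_companion e : \tr (smx (companion e)) = e.
Proof. by rewrite smx_companion tr22 !mxE /= add0r. Qed.

(** For a [class_distr] this is the common value of [p] at all non-scalar elements of trace [e], the
    companion matrix being one of them. *)
Definition trace_val p e := p (companion e).

Section ClassDistr.
Variables (K : R) (p : SLt -> R).
Hypotheses (p_class : class_distr K p) (q4 : 4 <= q).

Lemma class_distr_le u : p u <= K / q.
Proof.
case: p_class => p0 _ _ pe; apply: le_trans (pe (\tr (smx u))).
by rewrite (bigD1 u) //= lerDl sumr_ge0.
Qed.

Lemma class_distr_sreg u : sreg u -> p u = trace_val p (\tr (smx u)).
Proof.
by case: p_class => _ _ pc _ ur; apply: pc; rewrite ?sreg_companion ?tr_companion.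
Qed.

(** There are at least q (q - 1) elements of trace [e], of which at most two are scalar. *)
Lemma trace_val_le_sum e :
  trace_val p e * (q ^+ 2 - q - 2) <= \sum_(u | \tr (smx u) == e) p u.
Proof.
case: (p_class) => p0 _ _ _.
rewrite (bigID (@sreg F)) /= -[leLHS]addr0 lerD ?sumr_ge0 //.
rewrite (eq_bigr (fun=> trace_val p e)) => [|u /andP[/eqP <- ur]]; last first.
  exact: class_distr_sreg.
rewrite sumr_const -[trace_val p e *+ _]mulr_natr ler_wpM2l ?p0 //.
have /andP[lo _] := card_det_tr e (oner_neq0 F).
move: lo; rewrite -(card_smx_pred (fun A => \tr A == e)) => lo.
have : (#|[pred u : SLt | \tr (smx u) == e]| <=
  #|[pred u | (\tr (smx u) == e) && sreg u]| + #|[pred u : SLt | ~~ sreg u]|)%N.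
  rewrite -cardUI; apply: leq_trans (leq_addr _ _).
  apply: subset_leq_card; apply/fintype.subsetP => u; rewrite !inE => ->.
  by case: (sreg u).
move=> /(leq_trans lo) /leq_trans /(_ (leq_add (leqnn _) (card_not_sreg F))).
move=> h.
rewrite lerBlDr -natrD; apply: le_trans (_ : (#|F| * #|F|.-1)%:R <= _).
  rewrite natrM -subn1 natrB ?(ltnW (card_field_gt1 F)) //; lra.
by rewrite ler_nat; apply: leq_trans h _.
Qed.

Lemma sum_trace_val : \sum_e trace_val p e <= (q ^+ 2 - q - 2)^-1.
Proof.
have d0 := den_gt0 q4.
case: (p_class) => _ p1 _ _; rewrite -[leRHS]mul1r ler_pdivlMr // mulr_suml -[leRHS]p1.
rewrite [leRHS](partition_big (fun u : SLt => \tr (smx u)) xpredT) //=.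
by apply: ler_sum => e _; apply: trace_val_le_sum.
Qed.

(** Combines the trace bound K / q with q^2 <= 2 (q^2 - q - 2), which holds for q >= 4. *)
Lemma trace_val_le e : trace_val p e <= 2 * K / q ^+ 3.
Proof.
case: (p_class) => p0 _ _ /(_ e)/(le_trans (trace_val_le_sum e)).
have q0 : 0 < q by move: q4; lra.
rewrite !ler_pdivlMr ?exprn_gt0 // => h.
apply: le_trans (_ : 2 * (trace_val p e * (q ^+ 2 - q - 2) * q) <= _).
  have : trace_val p e * q ^+ 3 <= trace_val p e * (2 * (q ^+ 2 - q - 2) * q).
    rewrite ler_wpM2l ?p0 //.
    have : 0 <= q * (q ^+ 2 - 2 * q - 4) by rewrite mulr_ge0 ?(ltW q0) //; move: q4; nra.
    by lra.
  by lra.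
by lra.
Qed.

End ClassDistr.

Section ConvolutionBound.
Variables (K : R) (p1 p2 : SLt -> R).
Hypotheses (K1 : 1 <= K) (q4 : 4 <= q).
Hypotheses (p1_class : class_distr K p1) (p2_class : class_distr K p2).

Definition conv g := \sum_a p1 a^-1%g * p2 (a * g)%g.

Let p1_ge0 u : 0 <= p1 u. Proof. by case: p1_class. Qed.
Let p2_ge0 u : 0 <= p2 u. Proof. by case: p2_class. Qed.
Let q0 : 0 < q. Proof. by move: q4; lra. Qed.
Let Kq : 0 <= K / q. Proof. by rewrite divr_ge0 ?(ltW q0) //; move: K1; lra. Qed.
Let Kq3 : 0 <= 2 * K / q ^+ 3.
Proof. by rewrite divr_ge0 ?exprn_ge0 ?(ltW q0) //; move: K1; lra. Qed.

Let p1_le u : sreg u -> p1 u <= 2 * K / q ^+ 3.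
Proof. by move=> ur; rewrite (class_distr_sreg p1_class ur) trace_val_le. Qed.
Let p2_le u : sreg u -> p2 u <= 2 * K / q ^+ 3.
Proof. by move=> ur; rewrite (class_distr_sreg p2_class ur) trace_val_le. Qed.

Lemma conv_ge0 g : 0 <= conv g.
Proof. by apply: sumr_ge0 => a _; rewrite mulr_ge0. Qed.

Lemma sum_conv : \sum_g conv g = 1.
Proof.
rewrite exchange_big /=; have [_ s1 _ _] := p1_class; have [_ s2 _ _] := p2_class.
rewrite -s1 [RHS](reindex_inj invg_inj); apply: eq_bigr => a _.
by rewrite -mulr_sumr -[RHS]mulr1 -s2 [in RHS](reindex_inj (mulgI a)).
Qed.

Lemma sum_not_sreg_le (h : SLt -> R) (c : R) : 0 <= c ->
  (forall a, ~~ sreg a -> h a <= c) -> \sum_(a | ~~ sreg a) h a <= 2 * c.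
Proof.
move=> c0 hc; apply: le_trans (ler_sum _ hc) _.
rewrite sumr_const -[c *+ _]mulr_natl ler_wpM2r //.
by rewrite (ler_nat _ _ 2); apply: card_not_sreg.
Qed.

(** Multiplying by a scalar [g] keeps non-scalar elements non-scalar, so for those [a] the factor
    [p2] is O(q^-3) while [p1] has mass at most 1. Each of the at most two scalar [a] adds at most
    (K / q)^2. *)
Lemma conv_not_sreg g : ~~ sreg g -> conv g <= 2 * K / q ^+ 3 + 2 * (K / q) ^+ 2.
Proof.
move=> gr; rewrite /conv (bigID (@sreg F)) /= lerD //.
  apply: (@le_trans _ _ (\sum_(a | sreg a) p1 a^-1%g * (2 * K / q ^+ 3))).
    by apply: ler_sum => a ar; rewrite ler_wpM2l // p2_le // sregMr.
  rewrite -mulr_suml -[leRHS]mul1r ler_wpM2r //.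
  have [_ <- _ _] := p1_class; rewrite [leRHS](reindex_inj invg_inj).
  by rewrite [leRHS](bigID (@sreg F)) /= lerDl sumr_ge0.
apply: sum_not_sreg_le => [|a _]; first exact: sqr_ge0.
by rewrite expr2 ler_pM ?(class_distr_le p1_class) ?(class_distr_le p2_class).
Qed.

(** When [a] and a g are both non-scalar, the summand depends only on their traces (s, t). Replacing
    the number of such [a] by q gives the main term, at the cost of the mean deviation times the
    largest values of [p1] and [p2]. *)
Lemma conv_sreg g : sreg g ->
  conv g <= q / (q ^+ 2 - q - 2) ^+ 2 + 20 * K ^+ 2 * r / q ^+ 4.
Proof.
move=> gr; set f1 := trace_val p1; set f2 := trace_val p2.
have f1_0 e : 0 <= f1 e by apply: p1_ge0.
have f2_0 e : 0 <= f2 e by apply: p2_ge0.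
have r1 : 1 <= r by rewrite -[leLHS]sqrtr1 ler_sqrt //; move: q4; lra.
(* Bounds a product with one factor at a non-scalar element and the other at a scalar one. *)
pose c := 2 * K / q ^+ 3 * (K / q).
have c0 : 0 <= c by rewrite mulr_ge0.
have main : \sum_a f1 (\tr (smx a)) * f2 (\tr (smx a *m smx g)) <=
   q / (q ^+ 2 - q - 2) ^+ 2 + (2 * K / q ^+ 3) ^+ 2 * (3 * q ^+ 2 * r).
  have -> : \sum_a f1 (\tr (smx a)) * f2 (\tr (smx a *m smx g)) =
    \sum_s \sum_t f1 s * f2 t * (nb_traces g s t)%:R.
    rewrite (partition_big (fun u : SLt => \tr (smx u)) xpredT) //=.
    apply: eq_bigr => s _.
    rewrite (partition_big (fun u : SLt => \tr (smx u *m smx g)) xpredT) //=.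
    apply: eq_bigr => t _; rewrite mulr_natr -sumr_const.
    apply: eq_big => [a|a]; first by rewrite inE.
    by move=> /andP[/eqP-> /eqP->].
  have split_nb s t : f1 s * f2 t * (nb_traces g s t)%:R <=
    f1 s * f2 t * q + (2 * K / q ^+ 3) ^+ 2 * `|(nb_traces g s t)%:R - q|.
    rewrite -lerBlDl -mulrBr; set x := _%:R - q.
    apply: (@le_trans _ _ (f1 s * f2 t * `|x|)).
      by rewrite ler_wpM2l ?mulr_ge0 // ler_norm.
    rewrite ler_wpM2r // expr2 ler_pM //; exact: trace_val_le.
  apply: le_trans (ler_sum _ (fun s _ => ler_sum _ (fun t _ => split_nb s t))) _.
  under eq_bigr do rewrite big_split -mulr_suml -!mulr_sumr.
  rewrite big_split -mulr_sumr -!mulr_suml /= lerD //; last first.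
    by rewrite ler_wpM2l ?sqr_ge0 // sum_absdev_traces.
  rewrite mulrC ler_wpM2l ?(ltW q0) // expr2 invfM ler_pM ?sumr_ge0 //;
    by [exact: (sum_trace_val p1_class q4) | exact: (sum_trace_val p2_class q4)].
have -> : conv g = \sum_(a | sreg a && sreg (a * g)%g) p1 a^-1%g * p2 (a * g)%g
  + \sum_(a | sreg a && ~~ sreg (a * g)%g) p1 a^-1%g * p2 (a * g)%g
  + \sum_(a | ~~ sreg a) p1 a^-1%g * p2 (a * g)%g.
  by rewrite /conv (bigID (@sreg F)) /= (bigID (fun a => sreg (a * g)%g) (@sreg F)).
have b1 : \sum_(a | sreg a && sreg (a * g)%g) p1 a^-1%g * p2 (a * g)%g <=
    \sum_a f1 (\tr (smx a)) * f2 (\tr (smx a *m smx g)).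
  rewrite [leRHS](bigID (fun a => sreg a && sreg (a * g)%g)) /=.
  rewrite -[leLHS]addr0 lerD ?sumr_ge0 // => [|a _]; last by rewrite mulr_ge0.
  apply: ler_sum => a /andP[ar agr].
  rewrite (class_distr_sreg p1_class) ?sregV // tr_smxV.
  by rewrite (class_distr_sreg p2_class) // smxM.
have b2 : \sum_(a | sreg a && ~~ sreg (a * g)%g) p1 a^-1%g * p2 (a * g)%g <= 2 * c.
  apply: (@le_trans _ _ (\sum_(a | ~~ sreg (a * g)%g) c)).
    rewrite [leRHS](bigID (@sreg F)) /= -[leLHS]addr0 lerD ?sumr_ge0 //.
    rewrite (eq_bigl (fun a => ~~ sreg (a * g)%g && sreg a)) => [|a]; last exact: andbC.
    apply: ler_sum => a /andP[_ ar].
    by rewrite ler_pM // ?p1_le ?sregV // (class_distr_le p2_class).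
  rewrite (reindex_inj (mulIg g^-1%g)) /=.
  rewrite (eq_bigl (fun a => ~~ sreg a)) => [|a]; last by rewrite mulgKV.
  exact: sum_not_sreg_le.
have b3 : \sum_(a | ~~ sreg a) p1 a^-1%g * p2 (a * g)%g <= 2 * c.
  apply: sum_not_sreg_le => // a ar; rewrite /c mulrC ler_pM //.
    by rewrite p2_le // sregMl.
  exact: class_distr_le p1_class _.
apply: (le_trans (lerD (lerD (le_trans b1 main) b2) b3)).
(* The constant 20 is 12 from the deviation plus 8 from the four exceptional terms c, where r >=
   1. *)
have -> : (2 * K / q ^+ 3) ^+ 2 * (3 * q ^+ 2 * r) = 12 * K ^+ 2 * r / q ^+ 4.
  by field; rewrite lt0r_neq0.
have -> : c = 2 * K ^+ 2 / q ^+ 4 by rewrite /c; field; rewrite lt0r_neq0.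
have : K ^+ 2 / q ^+ 4 <= K ^+ 2 * r / q ^+ 4.
  rewrite ler_wpM2r ?invr_ge0 ?exprn_ge0 ?(ltW q0) //.
  by rewrite -[leLHS]mulr1 ler_wpM2l // sqr_ge0.
by rewrite -!mulrA; lra.
Qed.

(** Over the non-scalar elements the sum of squares is at most the maximum times the total mass 1;
    the at most two scalar elements are bounded separately. *)
Lemma sum_sqr_conv :
  #|SLt|%:R * \sum_g conv g ^+ 2 <= 1 + (100 * K ^+ 4) / r.
Proof.
have r0 : 0 < r by rewrite sqrtr_gt0.
have rr : r ^+ 2 = q by rewrite sqr_sqrtr // ltW.
have /andP[_ up] := card_SLt F.
have {}up : #|SLt|%:R <= q ^+ 3 + q ^+ 2 by rewrite -!natrX -natrD ler_nat.
have d0 := den_gt0 q4.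
pose A := q / (q ^+ 2 - q - 2) ^+ 2 + 20 * K ^+ 2 * r / q ^+ 4.
pose B := 2 * K / q ^+ 3 + 2 * (K / q) ^+ 2.
have A0 : 0 <= A.
  rewrite addr_ge0 ?divr_ge0 ?exprn_ge0 ?(ltW q0) ?(ltW d0) //.
  by apply: mulr_ge0 (ltW r0); apply: mulr_ge0 (sqr_ge0 _).
have B0 : 0 <= B by rewrite addr_ge0 // mulr_ge0 ?sqr_ge0.
have sumle : \sum_g conv g ^+ 2 <= A + 2 * B ^+ 2.
  rewrite (bigID (@sreg F)) /= lerD //; last first.
    apply: sum_not_sreg_le => [|g gr]; first exact: sqr_ge0.
    by rewrite lerXn2r ?nnegrE ?conv_ge0 ?conv_not_sreg.
  apply: (@le_trans _ _ (\sum_(g | sreg g) A * conv g)).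
    by apply: ler_sum => g gr; rewrite expr2 ler_wpM2r ?conv_ge0 ?conv_sreg.
  rewrite -mulr_sumr -[leRHS]mulr1 ler_wpM2l // -[leRHS]sum_conv.
  by rewrite [leRHS](bigID (@sreg F)) /= lerDl sumr_ge0 // => g _; apply: conv_ge0.
apply: le_trans (_ : (q ^+ 3 + q ^+ 2) * (A + 2 * B ^+ 2) <= _).
  by rewrite ler_pM // sumr_ge0 // => g _; apply: sqr_ge0.
exact: conv_numeric_bound.
Qed.

End ConvolutionBound.
End Convolution.

(** * Conclusion *)

Section WordDistribution.
Variables (R : realType) (F : finFieldType) (d : nat).
Local Open Scope ring_scope.

Notation SLt := (subg_of (SL2 F)).
Notation q := (#|F|%:R : R).

Definition sol_ratio (w : free_group d) (u : SLt) : R :=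
  (nb_sol w u)%:R / #|SLt|%:R ^+ d.

Let n0 : 0 < #|SLt|%:R ^+ d :> R.
Proof. by rewrite exprn_gt0 // ltr0n; apply/card_gt0P; exists 1%g. Qed.

Lemma sum_sol_ratio w (P : pred SLt) : \sum_(u | P u) sol_ratio w u =
  #|[set x : {ffun 'I_d -> SLt} | P (word_map w x)]|%:R / #|SLt|%:R ^+ d.
Proof. by rewrite -mulr_suml -natr_sum sum_nb_sol. Qed.

(** Enlarging K to L lets two words share one constant. *)
Lemma class_distr_sol_ratio (w : free_group d) (K L : nat) :
  (forall v : F, #|F| * #|[set x : {ffun 'I_d -> SLt} |
     \tr (smx (word_map w x)) == v]%R| <= K * #|SLt| ^ d)%N ->
  (K <= L)%N -> class_distr L%:R (sol_ratio w).
Proof.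
move=> wK KL; split=> [u||u v ur vr uv|e].
- by rewrite divr_ge0 // ltW.
- rewrite sum_sol_ratio (_ : [set x | _] = [set: {ffun 'I_d -> SLt}]%SET).
    by rewrite cardsT card_ffun card_ord natrX divff // lt0r_neq0.
  by apply/setP => x; rewrite !inE.
- by rewrite /sol_ratio (nb_sol_regular w ur vr uv).
have q0 : 0 < q by rewrite ltr0n (ltnW (card_field_gt1 F)).
rewrite sum_sol_ratio ler_pdivrMr // mulrAC ler_pdivlMr // mulrC.
by rewrite -natrX -!natrM ler_nat (leq_trans (wK e)) // leq_mul2r KL orbT.
Qed.

Lemma sol_ratioM (w1 w2 : free_group d) g : disjoint_words w1 w2 ->
  sol_ratio (w1 * w2)%g g = conv (sol_ratio w1) (sol_ratio w2) g.
Proof.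
move=> /(nb_solM g)/(congr1 (fun k : nat => k%:R : R)).
rewrite natrM natrX natr_sum => e; rewrite {1}/sol_ratio.
have {e}-> : (nb_sol (w1 * w2)%g g)%:R = (#|SLt|%:R ^+ d)^-1 *
    \sum_a (nb_sol w1 a^-1%g * nb_sol w2 (a * g)%g)%:R :> R.
  by rewrite -e mulKf // lt0r_neq0.
rewrite mulrC mulrA mulr_sumr; apply: eq_bigr => a _.
by rewrite natrM [RHS]mulrACA [RHS]mulrC.
Qed.

End WordDistribution.

(** * The projection from SL_2 to PSL_2 *)

Section Quotient.
Variable F : finFieldType.
Local Open Scope group_scope.

Notation SLt := (subg_of (SL2 F)).

Definition toPSL (u : SLt) : coset_of 'Z(SL2 F) := coset 'Z(SL2 F) (sgval u).

Lemma SL2_norm_center : SL2 F \subset 'N('Z(SL2 F)).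
Proof. exact: normal_norm (center_normal _). Qed.

Lemma toPSLM : {morph toPSL : u v / u * v}.
Proof.
by move=> u v; rewrite /toPSL /= morphM ?(fintype.subsetP SL2_norm_center) ?subgP.
Qed.

Lemma toPSL_im : toPSL @: [set: SLt]%SET = PSL2 F.
Proof.
apply/setP => h; apply/imsetP/morphimP => [[u _ ->]|[x _ xS ->]].
  by exists (sgval u); rewrite ?(fintype.subsetP SL2_norm_center) ?subgP.
by exists (subg _ x); rewrite // /toPSL subgK.
Qed.

End Quotient.

(** * From collision probability to the L^2 distance *)

Section L2.
Variables (R : realType) (d : nat).
Local Open Scope ring_scope.

Lemma word_map_group (gT : finGroupType) (G : {group gT}) (w : free_group d)
    (x : 'I_d -> gT) : (forall i, x i \in G) -> word_map w x \in G.
Proof.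
move=> xG; rewrite /word_map; elim: (letters w) => [|a s IHs].
  by rewrite big_nil group1.
rewrite big_cons groupM // /letter_map.
by case: a.2; rewrite ?groupV xG.
Qed.

Lemma sum_word_distr (gT : finGroupType) (G : {group gT}) (w : free_group d) :
  \sum_(g in G) word_distr R w G g = 1.
Proof.
rewrite -mulr_suml -natr_sum.
have -> : (\sum_(g in G) #|[set x : {ffun 'I_d -> gT} |
    (x \in ffun_on (mem G)) && (word_map w x == g)]| = #|G| ^ d)%N.
  rewrite -[d in RHS]card_ord -card_ffun_on -[RHS]sum1_card.
  rewrite (partition_big (fun x : {ffun 'I_d -> gT} => word_map w x) [in G]) /=.
    apply: eq_bigr => g _; rewrite sum1_card.
    by apply: eq_card => x; rewrite !inE.
  by move=> x /ffun_onP xG; apply: word_map_group.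
by rewrite natrX divff // expf_neq0 // pnatr_eq0 -lt0n cardG_gt0.
Qed.

(** Expanding the square, the cross term is -2 and the uniform term is 1, because the distribution
    has total mass 1. *)
Lemma L2norm_word_distr (gT : finGroupType) (G : {group gT}) (w : free_group d) :
  L2norm G (fun g => word_distr R w G g - unif_distr R G g) =
  Num.sqrt (#|G|%:R * \sum_(g in G) word_distr R w G g ^+ 2 - 1).
Proof.
have n0 : #|G|%:R != 0 :> R by rewrite pnatr_eq0 -lt0n cardG_gt0.
rewrite /L2norm; congr Num.sqrt.
rewrite (eq_bigr (fun g => word_distr R w G g ^+ 2 +
   (- (2 / #|G|%:R) * word_distr R w G g + #|G|%:R^-1 ^+ 2))) => [|g gG].
  rewrite !big_split /= -mulr_sumr sum_word_distr sumr_const.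
  rewrite -[_ *+ #|_|]mulr_natr; move: (#|G|%:R) n0 => n n0.
  by field.
by rewrite /unif_distr gG real_normK ?num_real // sqrrB; ring.
Qed.

Lemma L2norm_PSL2_le (w1 w2 : free_group d) :
  w1 <> 1%g -> w2 <> 1%g -> disjoint_words w1 w2 ->
  exists C : R, forall F : finFieldType, (4 <= #|F|)%N ->
  L2norm (PSL2 F) (fun g => word_distr R (w1 * w2)%g (PSL2 F) g
                            - unif_distr R (PSL2 F) g) <=
  Num.sqrt (C / Num.sqrt #|F|%:R).
Proof.
move=> /card_word_trace[K1 hK1] /card_word_trace[K2 hK2] dis.
(* The successor ensures 1 <= K, as the convolution bound requires. *)
pose K := (K1 + K2).+1; exists (100 * K%:R ^+ 4) => F q4.
rewrite L2norm_word_distr; apply: ler_wsqrtr.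
rewrite lerBlDl; apply: le_trans (collision_le _ _ (@toPSLM F) (toPSL_im F)) _.
rewrite (eq_bigr (fun g => conv (sol_ratio R w1) (sol_ratio R w2) g ^+ 2)) => [|g _].
  apply: sum_sqr_conv.
  - by rewrite ler1n.
  - by rewrite (ler_nat _ 4).
  - by apply: class_distr_sol_ratio (hK1 F) _; rewrite /K; lia.
  - by apply: class_distr_sol_ratio (hK2 F) _; rewrite /K; lia.
by rewrite -sol_ratioM.
Qed.

End L2.

(** * The limit over prime powers *)

Local Open Scope classical_set_scope.
Local Open Scope ring_scope.

Theorem corollary4p3 (R : realType) (d : nat) (w1 w2 : free_group d)
    (nt1 : w1 <> 1%g) (nt2 : w2 <> 1%g) (dis : disjoint_words w1 w2) :
  (fun q : nat =>
     L2norm (PSL2 (GF q))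
       (fun g => word_distr R (w1 * w2)%g (PSL2 (GF q)) g
                 - unif_distr R (PSL2 (GF q)) g))
    @ within [set q | prime_power q] \oo --> (0 : R).
Proof.
have [C hC] := L2norm_PSL2_le R nt1 nt2 dis.
apply/cvgrPdist_lt => e e0; rewrite near_withinE.
near=> q => qpp; rewrite sub0r normrN ger0_norm ?sqrtr_ge0 //.
have q4 : (4 <= q)%N by near: q; exists 4%N.
(* This threshold is what C / q^(1/2) < e^2 becomes after squaring; no sign of C is known, so the
   comparison below goes through the absolute value. *)
have qC : (C / e ^+ 2) ^+ 2 < q%:R by near: q; apply: nbhs_infty_gtr.
apply: le_lt_trans (hC (GF q) _) _; rewrite card_GF //.
have q0 : 0 < q%:R :> R by rewrite ltr0n (leq_trans _ q4).
have r0 : 0 < Num.sqrt q%:R :> R by rewrite sqrtr_gt0.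
rewrite -[ltRHS]gtr0_norm // -sqrtr_sqr ltr_sqrt ?exprn_gt0 //.
rewrite ltr_pdivrMr // mulrC -ltr_pdivrMr ?exprn_gt0 //.
apply: le_lt_trans (ler_norm _) _.
by rewrite -sqrtr_sqr ltr_sqrt.
Unshelve. all: by end_near.
Qed.
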